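(* Let $k,d\ge 1$, let $(\alpha_1,\dots,\alpha_k)\in\mathbb{T}^k$ be angles at least one of which is irrational, let $f:\mathbb{T}\to\Delta=\{0,1,\dots,d\}$ be a proper coloring function, let $z\in\mathbb{T}$, and let $$\varphi=m(f,z):\mathbb{Z}^k\to\{0,\dots,d\},\qquad \varphi(n_1,\dots,n_k)=f(z+n_1\alpha_1+\dots+n_k\alpha_k)$$ be the associated coding function. Then the symbolic $\mathbb{Z}^k$-system $G_\varphi\subset\{0,1,\dots,d\}^{\mathbb{Z}^k}$ is isomorphic (as a $\mathbb{Z}^k$-system) to a circularly ordered minimal metrizable $\mathbb{Z}^k$-system $\mathbb{T}_A$ for some $\mathbb{Z}^k$-invariant set $A\subset\mathbb{T}$. Furthermore, $G_\varphi$ is a tame $\mathbb{Z}^k$-system and $\varphi\in\mathrm{Tame}(\mathbb{Z}^k)$.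
   Context: Circular orders. A circular order on a set $X$ is a relation $R\subset X^3$ (write $[a,b,c]$ for $(a,b,c)\in R$) such that: $[a,b,c]\Rightarrow[b,c,a]$; $[a,b,c]\Rightarrow (a,c,b)\notin R$; $[a,b,c]$ and $[a,c,d]$ imply $[a,b,d]$; if $a,b,c$ are distinct then $[a,b,c]$ or $[a,c,b]$. For $a\ne b$ put $(a,b)_R=\{x:[a,x,b]\}$, $[a,b]_R=(a,b)_R\cup\{a,b\}$ and $[a,b)_R=(a,b)_R\cup\{a\}$; put $[a,a]_R=\{a\}$. The interval topology $\tau_R$ has the sets $(a,b)_R$ as a base. A map $f$ between circularly ordered sets is c-order preserving (COP) if (1) $[a,b,c]$ and $f(a),f(b),f(c)$ distinct imply $[f(a),f(b),f(c)]$; and (2) $f(a)=f(c)$ implies $f$ is constant on one of $[a,c]_R$, $[c,a]_R$. For a discrete group $G$, a compact $G$-system $X$ (compact Hausdorff space with a continuous $G$-action) is circularly ordered if there is a circular order $R$ on $X$ such that $\tau_R$ is the topology of $X$ and all translations $x\mapsto gx$ are COP. A compact system is minimal if every orbit is dense. Isomorphism of systems means equivariant homeomorphism. The circle $\mathbb{T}=\mathbb{R}/\mathbb{Z}$, identified as a set with $[0,1)$, carries the circular order $[x,y,z]$ iff $(y-x)(z-y)(z-x)>0$. Coloring. Let $c_0,c_1,\dots,c_d$ be distinct points of $\mathbb{T}$ in circular order, $d\ge1$, and $c_{d+1}=c_0$, so that $\mathbb{T}$ is the disjoint union of the arcs $[c_i,c_{i+1})$, $0\le i\le d$. A proper coloring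 function $f:\mathbb{T}\to\Delta=\{0,\dots,d\}$ is a function that is constant on each such arc and takes different values on different arcs. Subshift. $\mathbb{Z}^k$ acts on $\Delta^{\mathbb{Z}^k}$ (product topology, $\Delta$ discrete) by $(g\omega)(t)=\omega(t+g)$, and $G_\varphi$ is the closure of the orbit $\{g\varphi:g\in\mathbb{Z}^k\}$. The system $\mathbb{T}_A$. The group $\mathbb{Z}^k$ acts on $\mathbb{T}$ by $(n_1,\dots,n_k)\cdot t=t+n_1\alpha_1+\dots+n_k\alpha_k$. For a $\mathbb{Z}^k$-invariant $A\subset\mathbb{T}$, $\mathbb{T}_A$ is the set $(\mathbb{T}\setminus A)\cup\{a^-,a^+:a\in A\}$ obtained by splitting each $a\in A$ into two points, with the projection $\nu:\mathbb{T}_A\to\mathbb{T}$, $\nu(a^\pm)=a$, $\nu(x)=x$ for $x\notin A$. Its circular order is: $[p,q,r]$ holds iff either $[\nu(p),\nu(q),\nu(r)]$ holds in $\mathbb{T}$, or some cyclic permutation of $(p,q,r)$ has the form $(a^-,a^+,u)$ with $a\in A$ and $u\notin\{a^-,a^+\}$. The topology is the interval topology, and the action is $g(a^\pm)=(ga)^\pm$ for $a\in A$, $g(x)=gx$ for $x\notin A$. Tameness. A sequence $f_n:X\to\mathbb{R}$ is independent if there are reals $a<b$ such that $\bigcap_{n\in P}f_n^{-1}(-\infty,a)\cap\bigcap_{n\in M}f_n^{-1}(b,\infty)\ne\emptyset$ for all finite disjoint $P,M\subset\mathbb{N}$. A compact $G$-system $X$ is tame if for every continuous $f:X\to\mathbb{R}$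 the family $\{x\mapsto f(gx):g\in G\}$ contains no independent sequence. For a discrete group $G$ acting on itself by left translations, a bounded function $\varphi:G\to\mathbb{R}$ belongs to $\mathrm{Tame}(G)$ if there are a tame compact $G$-system $Y$, a $G$-equivariant map $\gamma:G\to Y$ with dense image, and a continuous $F:Y\to\mathbb{R}$ with $\varphi=F\circ\gamma$. *)

(* Defs.v *)
From HB Require Import structures.
From mathcomp Require Import all_boot all_order all_algebra.
From mathcomp Require Import all_classical all_reals all_analysis.
From mathcomp Require Import lra.
Set Implicit Arguments.
Unset Strict Implicit.
Unset Printing Implicit Defensive.
Import Order.TTheory GRing.Theory Num.Theory.
Import numFieldNormedType.Exports.
Local Open Scope classical_set_scope.
Local Open Scope ring_scope.

Section CircularOrder.
Context {X : Type} (C : X -> X -> X -> Prop).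

Definition circular_order : Prop :=
  [/\ forall a b c, C a b c -> C b c a,
      forall a b c, C a b c -> ~ C a c b,
      forall a b c d, C a b c -> C a c d -> C a b d &
      forall a b c, a <> b -> b <> c -> a <> c -> C a b c \/ C a c b].

(* The intervals (a, b)_C, [a, b]_C and [a, b)_C.  For a circular order,
   (a, a)_C is empty, so the last two are {a} when a = b. *)
Definition cint_oo (a b : X) : set X := [set x | C a x b].
Definition cint_cc (a b : X) : set X := cint_oo a b `|` [set a; b].
Definition cint_co (a b : X) : set X := cint_oo a b `|` [set a].

(* U is a union of sets (a, b)_C with a <> b *)
Definition cinterval_open (U : set X) : Prop :=
  forall x, U x ->
    exists a b, [/\ a <> b, cint_oo a b x & cint_oo a b `<=` U].

End CircularOrder.

Definition constant_on (X Y : Type) (f : X -> Y) (D : set X) : Prop :=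
  forall x y, D x -> D y -> f x = f y.

Definition COP (X Y : Type) (C : X -> X -> X -> Prop) (C' : Y -> Y -> Y -> Prop)
    (f : X -> Y) : Prop :=
  (forall a b c, C a b c -> f a <> f b -> f b <> f c -> f a <> f c ->
     C' (f a) (f b) (f c)) /\
  (forall a c, f a = f c ->
     constant_on f (cint_cc C a c) \/ constant_on f (cint_cc C c a)).

Section IntervalTopology.
Context {X : Type} (C : X -> X -> X -> Prop) (hC : circular_order C).

Lemma corder_neq a b c : C a b c -> [/\ a <> b, b <> c & a <> c].
Proof.
have [cyc asym _ _] := hC.
have ac u v w : C u v w -> u <> w.
  by move=> uvw uw; subst w; exact: asym (cyc _ _ _ uvw) (cyc _ _ _ uvw).
move=> abc; have bca := cyc _ _ _ abc; have cab := cyc _ _ _ bca.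
by split; [exact: nesym (ac _ _ _ bca)|exact: nesym (ac _ _ _ cab)|exact: ac abc].
Qed.

Lemma cinterval_openT (p q r : X) : p <> q -> q <> r -> p <> r ->
  cinterval_open C setT.
Proof.
have [cyc _ _ tot] := hC => pq qr pr x _.
have between u v : u <> v -> u <> x -> v <> x ->
    exists a b, [/\ a <> b, cint_oo C a b x & cint_oo C a b `<=` setT].
  move=> uv ux vx; case: (tot u x v ux (nesym vx) uv) => [h|/cyc h].
    by exists u, v.
  by exists v, u; split => //; exact: nesym uv.
have [px|px] := pselect (p = x); first by apply: (between q r) => //; congruence.
have [qx|qx] := pselect (q = x); first by apply: (between p r) => //; congruence.
exact: (between p q).
Qed.

Lemma cint_shrinkl x a a' b : C a x b -> C x a a' ->
  C a' x b /\ cint_oo C a' b `<=` cint_oo C a b.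
Proof.
move=> axb xaa'; have [cyc _ trans _] := hC; have xba := cyc _ _ _ axb.
split; first exact: cyc (cyc _ _ _ (trans _ _ _ _ xba xaa')).
move=> y a'yb; have ba'y : C b a' y by exact: cyc (cyc _ _ _ a'yb).
have baa' := cyc _ _ _ (cyc _ _ _ (trans _ _ _ _ (cyc _ _ _ xaa') axb)).
exact: cyc (trans _ _ _ _ baa' ba'y).
Qed.

Lemma cint_shrinkr x a b b' : C a x b -> C x b' b ->
  C a x b' /\ cint_oo C a b' `<=` cint_oo C a b.
Proof.
move=> axb xb'b; have [cyc _ trans _] := hC; have xba := cyc _ _ _ axb.
split; first exact: cyc (cyc _ _ _ (trans _ _ _ _ xb'b xba)).
move=> y ayb'; refine (trans _ _ _ _ ayb' _).
exact: cyc (trans _ _ _ _ (cyc _ _ _ xba) (cyc _ _ _ (cyc _ _ _ xb'b))).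
Qed.

Lemma cinterval_openI (U V : set X) :
  cinterval_open C U -> cinterval_open C V -> cinterval_open C (U `&` V).
Proof.
have [cyc _ _ tot] := hC => oU oV x [/oU[a [b [_ axb abU]]]].
move=> /oV[c [d [_ cxd cdV]]]; rewrite {1}/cint_oo /= in axb cxd.
have [[ax xb _] [cx xd _]] := (corder_neq axb, corder_neq cxd).
have [l [lxb lab lxd lcd]] : exists l, [/\ C l x b,
    cint_oo C l b `<=` cint_oo C a b, C l x d & cint_oo C l d `<=` cint_oo C c d].
  have [ac|ac] := pselect (a = c); first by subst c; exists a; split => // ?.
  have [h|h] := tot x a c (nesym ax) ac (nesym cx).
    by have [? ?] := cint_shrinkl axb h; exists c; split => // ?.
  by have [? ?] := cint_shrinkl cxd h; exists a; split => // ?.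
have [r [lxr rab rcd]] : exists r, [/\ C l x r,
    cint_oo C l r `<=` cint_oo C l b & cint_oo C l r `<=` cint_oo C l d].
  have [bd|bd] := pselect (b = d); first by subst d; exists b; split => // ?.
  have [h|h] := tot x b d xb bd xd.
    by have [? ?] := cint_shrinkr lxd h; exists b; split => // ?.
  by have [? ?] := cint_shrinkr lxb h; exists d; split => // ?.
exists l, r; split => //; first by have [] := corder_neq lxr.
by move=> y /[dup] /rab/lab/abU ? /rcd/lcd/cdV.
Qed.

Lemma cinterval_open_bigU (I : Type) (F : I -> set X) :
  (forall i, cinterval_open C (F i)) -> cinterval_open C (\bigcup_i F i).
Proof.
move=> oF x [i _ /oF[a [b [ab axb sub]]]]; exists a, b; split => // y /sub.
by exists i.
Qed.

End IntervalTopology.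

Section Systems.
Context {G : zmodType}.

Definition is_action (X : Type) (act : G -> X -> X) : Prop :=
  (forall x, act 0 x = x) /\
  (forall g h x, act (g + h) x = act g (act h x)).

Definition compact_system (X : topologicalType) (act : G -> X -> X) : Prop :=
  [/\ compact [set: X], hausdorff_space X, is_action act &
      forall g, continuous (act g)].

Definition circularly_ordered_by (X : topologicalType)
    (C : X -> X -> X -> Prop) (act : G -> X -> X) : Prop :=
  [/\ circular_order C, forall U : set X, open U <-> cinterval_open C U &
      forall g, COP C C (act g)].

Definition minimal (X : topologicalType) (act : G -> X -> X) : Prop :=
  forall x, dense (range (fun g => act g x)).

Definition isomorphic (X Y : topologicalType) (actX : G -> X -> X)
    (actY : G -> Y -> Y) : Prop :=
  exists (h : X -> Y) (h' : Y -> X),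
    [/\ cancel h h', cancel h' h, continuous h, continuous h' &
        forall g x, h (actX g x) = actY g (h x)].

Definition independent (R : realType) (X : Type) (u : nat -> X -> R) : Prop :=
  exists a b, a < b /\
    forall P M : set nat, finite_set P -> finite_set M -> P `&` M = set0 ->
      (\bigcap_(n in P) [set x | u n x < a]) `&`
      (\bigcap_(n in M) [set x | b < u n x]) !=set0.

Definition tame_system (R : realType) (X : topologicalType)
    (act : G -> X -> X) : Prop :=
  compact_system act /\
  forall f : X -> R, continuous f ->
    ~ exists u : nat -> X -> R,
        (forall n, range (fun g x => f (act g x)) (u n)) /\ independent u.

Definition tame_function (R : realType) (phi : G -> R) : Prop :=
  (exists B, forall g, `|phi g| <= B) /\
  exists (Y : topologicalType) (act : G -> Y -> Y) (gamma : G -> Y) (F : Y -> R),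
    [/\ tame_system R act,
        forall g h, gamma (g + h) = act g (gamma h),
        dense (range gamma),
        continuous F &
        forall g, phi g = F (gamma g)].

End Systems.

Definition metrizable (R : realType) (X : topologicalType) : Prop :=
  exists d : X -> X -> R,
    [/\ forall x y, 0 <= d x y,
        forall x y, d x y = 0 <-> x = y,
        forall x y, d x y = d y x,
        forall x y z, d x z <= d x y + d y z &
        forall U : set X, open U <->
          forall x, U x -> exists2 e, 0 < e & [set y | d x y < e] `<=` U].

Section Symbolic.
Context {G : zmodType} {D : choiceType}.

Definition full_shift : topologicalType :=
  prod_topology (fun _ : G => discrete_topology D).

Definition shift_act (g : G) (w : full_shift) : full_shift := fun t => w (t + g).

Lemma shift_continuous g : continuous (shift_act g).
Proof.
move=> w; have FF : Filter (nbhs w) by exact: nbhs_filter.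
have FF' : Filter (shift_act g @ nbhs w) by exact: fmap_filter.
apply/cvg_sup => t; move: w {FF FF'}.
apply/(@continuousP _ (initial_topology (@^~ t))) => A [B oB <-].
have -> : shift_act g @^-1` (@^~ t @^-1` B) = proj (t + g) @^-1` B by [].
by apply: open_comp => // + _; exact: proj_continuous.
Qed.

Definition orbit_closure (phi : G -> D) : set full_shift :=
  closure (range (fun g => shift_act g (phi : full_shift))).

Lemma orbit_closure_shift (phi : G -> D) g w :
  orbit_closure phi w -> orbit_closure phi (shift_act g w).
Proof.
move=> clw U /(shift_continuous (g := g)) /clw[_ [[h _ <-] Uh]].
exists (shift_act (h + g) (phi : full_shift)); split; first by exists (h + g).
rewrite /= in Uh; congr (U _): Uh; apply: funext => t.
by rewrite /shift_act -addrA (addrC g).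
Qed.

(* The action on the subsystem, a subtype with the induced topology. *)
Definition orbit_closure_act (phi : G -> D) (g : G)
    (w : set_type (orbit_closure phi)) : set_type (orbit_closure phi) :=
  SigSub (mem_set (orbit_closure_shift (g := g) (set_valP w))).

End Symbolic.

Section Circle.
Context {R : realType}.

(* [R/Z] through the representatives in [0, 1). *)
Definition circle : Type := {x : R | 0 <= x < 1}.

Lemma frac_proof (x : R) : 0 <= x - (Num.floor x)%:~R < 1.
Proof.
by rewrite subr_ge0 ge_floor/= ltrBlDl -[1]/(1%:~R) -intrD floorD1_gt.
Qed.

Definition to_circle (x : R) : circle :=
  exist (fun y : R => 0 <= y < 1) _ (frac_proof x).

Definition circle_order (x y z : circle) : Prop :=
  0 < (val y - val x) * (val z - val y) * (val z - val x).

End Circle.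
Arguments circle : clear implicits.

Section Rotation.
Context {R : realType} {k : nat} (alpha : 'I_k -> circle R).

Definition circle_rot (n : {ffun 'I_k -> int}) (t : circle R) : circle R :=
  to_circle (val t + \sum_(i < k) val (alpha i) *~ n i).

Lemma to_circleDz (x : R) (m : int) : to_circle (x + m%:~R) = to_circle x.
Proof.
apply: val_inj => /=; rewrite floorDrz ?intr_int// intrKfloor intrD.
by rewrite opprD addrACA subrr addr0.
Qed.

Lemma to_circle_val (t : circle R) : to_circle (val t) = t.
Proof.
apply: val_inj => /=; have t01 := valP t.
by rewrite (@floor_def _ _ 0) ?subr0.
Qed.

Lemma rot_action : is_action circle_rot.
Proof.
split=> [t|g h t]; rewrite /circle_rot.
  rewrite big1 ?addr0 ?to_circle_val// => i _.
  by rewrite ffunE mulr0z.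
have -> : \sum_(i < k) val (alpha i) *~ (g + h) i =
    \sum_(i < k) val (alpha i) *~ g i + \sum_(i < k) val (alpha i) *~ h i.
  by rewrite -big_split; apply: eq_bigr => i _; rewrite ffunE mulrzDr.
rewrite (addrC (\sum_(i < k) _ *~ g i)) addrA /=.
set x := val t + _; rewrite -(to_circleDz _ (- Num.floor x)) intrN.
by rewrite addrAC.
Qed.

End Rotation.

(* c enumerates the endpoints only: f may take any of the colors on the i-th
   arc [c_i, c_(i+1)).  ordS is the cyclic successor, so c_(d+1) = c_0. *)
Definition proper_coloring (R : realType) (d : nat)
    (f : circle R -> 'I_d.+1) : Prop :=
  exists c : 'I_d.+1 -> circle R,
    let arc i := cint_co circle_order (c i) (c (ordS i)) in
    [/\ injective c,
        forall i j l : 'I_d.+1, (i < j < l)%N -> circle_order (c i) (c j) (c l),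
        forall i, constant_on f (arc i) &
        forall i j x y, i <> j -> arc i x -> arc j y -> f x <> f y].

Definition coding (R : realType) (k d : nat) (alpha : 'I_k -> circle R)
    (f : circle R -> 'I_d.+1) (z : circle R) (n : {ffun 'I_k -> int}) : 'I_d.+1 :=
  f (circle_rot alpha n z).

Section Split.
Context {R : realType}.

Inductive split_circle (A : set (circle R)) : Type :=
| Uncut (x : circle R) of ~ A x
| Minus (a : circle R) of A a
| Plus (a : circle R) of A a.

Context {A : set (circle R)}.

Definition split_proj (p : split_circle A) : circle R :=
  match p with Uncut x _ => x | Minus a _ => a | Plus a _ => a end.

(* (p, q, u) is (a^-, a^+, u) with u distinct from a^- and a^+ *)
Definition split_jump (p q u : split_circle A) : Prop :=
  exists (a : circle R) (Aa : A a),
    [/\ p = Minus Aa, q = Plus Aa, u <> Minus Aa & u <> Plus Aa].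

Definition split_order (p q r : split_circle A) : Prop :=
  circle_order (split_proj p) (split_proj q) (split_proj r) \/
  [\/ split_jump p q r, split_jump q r p | split_jump r p q].

(* The lexicographic linear order behind split_order. *)
Let is_plus (p : split_circle A) := if p is Plus _ _ then true else false.
Let lt (p q : split_circle A) : Prop :=
  val (split_proj p) < val (split_proj q) \/
  val (split_proj p) = val (split_proj q) /\ ~~ is_plus p && is_plus q.

Let split_eq p q : val (split_proj p) = val (split_proj q) ->
  is_plus p = is_plus q -> p = q.
Proof.
move=> /val_inj; case: p => p hp; case: q => q hq //= pq; subst q => //=;
  by rewrite ?(Prop_irrelevance hp hq).
Qed.

Let split_jumpE p q u : split_jump p q u <->
  [/\ val (split_proj p) = val (split_proj q), ~~ is_plus p, is_plus q &
      val (split_proj u) <> val (split_proj p)].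
Proof.
split.
  move=> [a [Aa [-> -> up uq]]]; split => //= /val_inj ua.
  case: u up uq ua => u hu /= + + ua; subst u => //;
    by rewrite (Prop_irrelevance hu Aa).
case=> /val_inj; case: p => // a Aa; case: q => // b Ab /= ab _ _ ua; subst b.
  by [].
exists a, Ab; rewrite (Prop_irrelevance Aa Ab).
by split => // e; apply: ua; rewrite e.
Qed.

Let circle_orderE (x y z : circle R) : circle_order x y z <->
  [\/ val x < val y /\ val y < val z, val y < val z /\ val z < val x |
      val z < val x /\ val x < val y].
Proof.
rewrite /circle_order; move: (val x) (val y) (val z) => {}x {}y {}z.
have pos3 (u v w : R) : 0 < u -> 0 < v -> 0 < w -> 0 < u * v * w.
  by move=> *; rewrite !mulr_gt0.
split.
  have [xy|yx|->] := ltgtP x y; last by rewrite subrr !mul0r ltxx.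
    have [yz|zy|->] := ltgtP y z; first by move=> _; apply: Or31.
      have [xz|zx|->] := ltgtP x z; last by rewrite subrr mulr0 ltxx.
        have := pos3 (y - x) (y - z) (z - x); rewrite !subr_gt0 => /(_ xy zy xz).
        by move=> + h; lra.
      by move=> _; apply: Or33.
    by rewrite subrr mulr0 mul0r ltxx.
  have [yz|zy|->] := ltgtP y z.
  - have [xz|zx|->] := ltgtP x z; last by rewrite subrr mulr0 ltxx.
      have := pos3 (x - y) (z - y) (z - x); rewrite !subr_gt0 => /(_ yx yz xz).
      by move=> + h; lra.
    by move=> _; apply: Or32.
  - have zx := lt_trans zy yx.
    have := pos3 (x - y) (y - z) (x - z); rewrite !subr_gt0 => /(_ yx zy zx).
    by move=> + h; lra.
  - by rewrite subrr mulr0 mul0r ltxx.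
case=> -[h1 h2].
- by apply: pos3; lra.
- have := pos3 (x - y) (z - y) (x - z); rewrite !subr_gt0.
  by move=> /(_ (lt_trans h1 h2) h1 h2); lra.
- have := pos3 (y - x) (y - z) (x - z); rewrite !subr_gt0.
  by move=> /(_ h2 (lt_trans h1 h2) h1); lra.
Qed.

Let split_cyc p q r : split_order p q r -> split_order q r p.
Proof.
case=> [/circle_orderE h|[h|h|h]].
- left; apply/circle_orderE; by case: h => [[? ?]|[? ?]|[? ?]];
    [apply: Or33|apply: Or31|apply: Or32].
- by right; apply: Or33.
- by right; apply: Or31.
- by right; apply: Or32.
Qed.

Let lt_trans' p q r : lt p q -> lt q r -> lt p r.
Proof.
case=> [pq|[pq /andP[np qp]]] [qr|[qr /andP[nq rp]]].
- by left; exact: lt_trans qr.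
- by left; rewrite -qr.
- by left; rewrite pq.
- by rewrite qp in nq.
Qed.

Let lt_irr p : ~ lt p p.
Proof. by rewrite /lt ltxx; case: (is_plus p) => -[|[]]. Qed.

Let lt_total p q : p <> q -> lt p q \/ lt q p.
Proof.
move=> pq; rewrite /lt.
have [?|?|e] := ltgtP (val (split_proj p)) (val (split_proj q)); [by left; left|
  by right; left|].
case pp: (is_plus p); case qq: (is_plus q).
- by case: pq; apply: split_eq => //; rewrite pp qq.
- by right; right.
- by left; right.
- by case: pq; apply: split_eq => //; rewrite pp qq.
Qed.

Let split_orderE p q r : split_order p q r <->
  [\/ lt p q /\ lt q r, lt q r /\ lt r p | lt r p /\ lt p q].
Proof.
have jump u v w : split_jump u v w -> lt u v /\ (lt w u \/ lt v w).
  move=> /split_jumpE[uv nu pv wu]; split; first by right; rewrite nu pv.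
  have [?|?|//] := ltgtP (val (split_proj w)) (val (split_proj u)).
    by left; left.
  by right; left; rewrite -uv.
have lin u v w : lt u v -> lt v w -> split_order u v w.
  case=> [uv|[uv /andP[nu pv]]] [vw|[vw /andP[nv pw]]].
  - by left; apply/circle_orderE; apply: Or31.
  - right; apply: Or32; apply/split_jumpE; split => //.
    by move=> e; rewrite e ltxx in uv.
  - right; apply: Or31; apply/split_jumpE; split => //.
    by move=> e; rewrite e uv ltxx in vw.
  - by rewrite pv in nv.
split.
  case=> [/circle_orderE[] [h1 h2]|[/jump|/jump|/jump] [h1 h2]].
  - by apply: Or31; split; left.
  - by apply: Or32; split; left.
  - by apply: Or33; split; left.
  - by case: h2 => ?; [apply: Or33|apply: Or31].
  - by case: h2 => ?; [apply: Or31|apply: Or32].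
  - by case: h2 => ?; [apply: Or32|apply: Or33].
case=> [] [h1 h2]; first exact: lin.
  exact: split_cyc (split_cyc (lin _ _ _ h1 h2)).
exact: split_cyc (lin _ _ _ h1 h2).
Qed.

Lemma split_circular_order : circular_order split_order.
Proof.
have asym p q : lt p q -> lt q p -> False by move=> h /(lt_trans' h)/lt_irr.
split.
- by move=> a b c; exact: split_cyc.
- move=> a b c /split_orderE[] [h1 h2] /split_orderE[] [h3 h4];
    by eauto using lt_trans'.
- move=> a b c e /split_orderE[] [h1 h2] /split_orderE[] [h3 h4];
    try (exfalso; by eauto using lt_trans');
    apply/split_orderE; by [apply: Or31; eauto using lt_trans'|
      apply: Or32; eauto using lt_trans'|apply: Or33; eauto using lt_trans'].
- move=> a b c ab bc ac.
  have [h1|h1] := lt_total ab; have [h2|h2] := lt_total bc;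
    have [h3|h3] := lt_total ac; try (exfalso; by eauto using lt_trans');
    (left; apply/split_orderE; by [apply: Or31|apply: Or32|apply: Or33]) ||
    (right; apply/split_orderE; by [apply: Or31|apply: Or32|apply: Or33]).
Qed.

Lemma split_lift (x : circle R) : exists p : split_circle A, split_proj p = x.
Proof.
by have [h|h] := pselect (A x); [exists (Minus h)|exists (Uncut h)].
Qed.

Lemma split_three : exists p q r : split_circle A, [/\ p <> q, q <> r & p <> r].
Proof.
have h0 : 0 <= (0 : R) < 1 by lra.
have h1 : 0 <= (1 / 3 : R) < 1 by lra.
have h2 : 0 <= (2 / 3 : R) < 1 by lra.
pose pt (y : R) (hy : 0 <= y < 1) : circle R := exist _ y hy.
have [p hp] := split_lift (pt _ h0).
have [q hq] := split_lift (pt _ h1).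
have [r hr] := split_lift (pt _ h2).
have neq (u v : split_circle A) :
  val (split_proj u) <> val (split_proj v) -> u <> v by move=> + e; rewrite e.
by exists p, q, r; split; apply: neq; rewrite ?hp ?hq ?hr /= => e; lra.
Qed.

Lemma split_openT : cinterval_open split_order setT.
Proof.
have [p [q [r [pq qr pr]]]] := split_three.
exact: (cinterval_openT split_circular_order pq qr pr).
Qed.

End Split.
Arguments split_circle {R} A.
Arguments split_order {R} A p q r.

HB.instance Definition _ (R : realType) (A : set (circle R)) :=
  gen_eqMixin (split_circle A).
HB.instance Definition _ (R : realType) (A : set (circle R)) :=
  gen_choiceMixin (split_circle A).
(* The interval topology of split_order. *)
HB.instance Definition _ (R : realType) (A : set (circle R)) :=
  isOpenTopological.Build (split_circle A) (@split_openT R A)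
    (fun U V => @cinterval_openI _ _ (@split_circular_order R A) U V)
    (fun I F => @cinterval_open_bigU _ _ I F).

Section SplitAction.
Context {R : realType} {k : nat} (alpha : 'I_k -> circle R) (A : set (circle R)).

Definition rot_invariant : Prop := forall n x, A x -> A (circle_rot alpha n x).

Context (invA : rot_invariant).

Lemma rot_invariantC (n : {ffun 'I_k -> int}) x : ~ A x -> ~ A (circle_rot alpha n x).
Proof.
have [act0 actD] := rot_action alpha.
by move=> nAx /(invA (- n)); rewrite -actD addNr act0.
Qed.
Arguments rot_invariantC n {x}.

Definition split_act (n : {ffun 'I_k -> int}) (p : split_circle A) :
    split_circle A :=
  match p with
  | Uncut x nAx => Uncut (x := circle_rot alpha n x) (rot_invariantC n nAx)
  | Minus a Aa => Minus (a := circle_rot alpha n a) (invA n Aa)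
  | Plus a Aa => Plus (a := circle_rot alpha n a) (invA n Aa)
  end.

End SplitAction.

(* Main.v *)
Require Import Defs.
From mathcomp Require Import all_boot all_order all_algebra.
From mathcomp Require Import all_classical all_reals all_analysis.
From mathcomp Require Import lra ring zify.
Set Implicit Arguments.
Unset Strict Implicit.
Unset Printing Implicit Defensive.
Import Order.TTheory GRing.Theory Num.Theory.
Import numFieldNormedType.Exports.
Local Open Scope classical_set_scope.
Local Open Scope ring_scope.

(** Let A be the union of the orbits of the cut points c_i.  On the circle f
    jumps at the c_i, and since the arcs are closed on the left, splitting c_i
    and giving the color f (c_i) to c_i^+ and the left limit of f to c_i^- turns
    f into a locally constant map [split_color] on the split circle T_A
    ([split_color_nbhs]).  The itinerary p |-> (n |-> color of n p) is then
    continuous and equivariant into the full shift, and the whole theorem rests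
    on the fact that it is injective ([split_itinerary_separating]).  Two points
    over the same a in A are told apart at the time when a is moved to some c_i.
    Two points over distinct x, y cannot have the same itinerary: since the
    orbits are dense and f is right continuous, f would have the period y - x,
    whereas a coloring whose arcs have distinct colors has no period
    ([coloring_aperiodic]).

    T_A is compact ([split_compact]: an ultrafilter converges on the circle to
    some x, and then to x^- or x^+ according to the side that it charges), and
    minimal ([split_minimal]: a neighborhood in T_A contains a one-sided
    neighborhood of the circle, which every orbit meets because one angle is
    irrational).  So the itinerary map is a homeomorphism onto a closed
    invariant set, in which the itinerary of z (or of z^+) is phi; by minimality
    this set is the orbit closure of phi.  Countably many clopen coordinates
    separate the points of T_A, hence metrizability.

    Tameness is a counting argument.  The pattern of phi on a finite set S of
    times, seen from x, changes only when x crosses one of the (d + 1) #|S|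
    points c_i - s, so there are at most (d + 1) #|S| + 1 patterns
    ([coding_complexity]).  A continuous function on the subshift depends up to
    a small error on the coordinates in a finite set E, so the values of m of
    its translates are controlled by the pattern on m #|E| times.  An
    independent sequence would produce 2^m patterns, which is impossible for
    large m ([linear_complexity_tame]). *)

(** * Clopen codings of compact spaces *)

(** A family of codes u_i with values in discrete spaces: each u_i is
    locally constant, and the codes of a point determine it. *)
Definition separating (X : topologicalType) (I D : Type)
    (u : I -> X -> D) : Prop :=
  (forall i x, nbhs x [set y | u i y = u i x]) /\
  (forall x y, (forall i, u i x = u i y) -> x = y).

Section Separating.
Context {X : topologicalType} {I : choiceType} {D : Type} {u : I -> X -> D}.
Context (sep_u : separating u).

Lemma separating_hausdorff : hausdorff_space X.
Proof.
move=> p q clpq; apply: sep_u.2 => i.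
by have [r [/= <- <-]] := clpq _ _ (sep_u.1 i p) (sep_u.1 i q).
Qed.

(** The uniform form of compactness: a property of pairs that holds near
    the diagonal already follows from the agreement of finitely many codes.
    Otherwise the pairs violating it and agreeing on larger and larger finite
    sets of codes cluster at some (x, y); the codes of x and y all agree, so
    this is a point of the diagonal. *)
Lemma separating_compact_finite (P : X -> X -> Prop) : compact [set: X] ->
  (forall x : X, exists2 V : set X,
     nbhs x V & forall p q, V p -> V q -> P p q) ->
  exists E : seq I, forall p q, (forall i, i \in E -> u i p = u i q) -> P p q.
Proof.
move=> cX locP; apply: contrapT => noE.
pose agree (E : seq I) := [set pq : X * X |
  (forall i, i \in E -> u i pq.1 = u i pq.2) /\ ~ P pq.1 pq.2].
have agree0 E : agree E !=set0.
  have /existsNP[p /existsNP[q /not_implyP[? ?]]] := (forallNP _).2 noE E.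
  by exists (p, q).
pose F := filter_from setT agree.
have FF : ProperFilter F.
  apply: filter_from_proper => [|E _]; last exact: agree0.
  apply: filter_from_filter; first by exists [::].
  move=> E E' _ _; exists (E ++ E') => // pq [ag nP].
  by split; split=> // i iE; apply: ag; rewrite mem_cat iE ?orbT.
have [|[x y] [_ clxy]] := compact_setX cX cX FF.
  by exists [::].
have {}clxy U V (E : seq I) : nbhs x U -> nbhs y V ->
    exists p q, [/\ U p, V q & agree E (p, q)].
  move=> xU yV; have [||[p q] [/= ag [? ?]]] := clxy (agree E) (U `*` V).
  - by exists E.
  - by exists (U, V).
  - by exists p, q.
have xy : x = y.
  apply: sep_u.2 => i.
  have [p [q [/= <- <- [ag _]]]] :=
    clxy _ _ [:: i] (sep_u.1 i x) (sep_u.1 i y).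
  by apply: ag; rewrite mem_head.
have [V xV VP] := locP x.
have yV : nbhs y V by rewrite -xy.
have [p [q [Vp Vq [_]]]] := clxy _ _ [::] xV yV.
by apply; exact: VP.
Qed.

Lemma separating_compact_nbhs (p : X) (U : set X) : compact [set: X] ->
  nbhs p U ->
  exists E : seq I, forall q, (forall i, i \in E -> u i p = u i q) -> U q.
Proof.
move=> cX pU.
have [|E EP] := @separating_compact_finite (fun x y => x = p -> U y) cX.
  move=> x; have [->|xp] := pselect (x = p).
    by exists U.
  have /existsNP[i uxp] : ~ forall i, u i x = u i p by move/sep_u.2.
  exists [set y | u i y = u i x]; first exact: sep_u.1.
  by move=> y q /= uyx _ yp; case: uxp; rewrite -yp.
by exists E => q /EP; exact.
Qed.

End Separating.

(** The metric is the ultrametric 1 / (n + 1), n being the least length of an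
    initial segment of codes on which two points disagree. *)
Lemma separating_compact_metrizable (R : realType) (X : topologicalType)
    (I : countType) (D : Type) (u : I -> X -> D) :
  compact [set: X] -> separating u -> metrizable R X.
Proof.
move=> cX sep_u.
pose agree n p q := forall i, (pickle i < n)%N -> u i p = u i q.
have agreeC n p q : agree n p q -> agree n q p by move=> h i /h.
have agreeT n p q r : agree n p q -> agree n q r -> agree n p r.
  by move=> h h' i ni; rewrite h ?h'.
have agreeW m n p q : (m <= n)%N -> agree n p q -> agree m p q.
  by move=> mn h i im; apply: h; exact: leq_trans mn.
have ex_split p q : p <> q -> exists n, `[< ~ agree n p q >].
  move=> pq; have /existsNP[i uxp] : ~ forall i, u i p = u i q by move/sep_u.2.
  by exists (pickle i).+1; apply/asboolP => /(_ i (ltnSn _)).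
pose d p q : R := if pselect (p = q) is right pq
  then (ex_minn (ex_split p q pq)).+1%:R^-1 else 0.
have d_ltP p q n : d p q < n.+1%:R^-1 <-> agree n p q.
  rewrite /d; case: pselect => [->|pq]; first by split=> // _; rewrite invr_gt0.
  case: ex_minnP => m /asboolP npq min_m.
  rewrite ltf_pV2 ?posrE// ltr_nat ltnS; split=> [nm|pqn].
    by apply: contrapT => /asboolP/min_m; rewrite leqNgt nm.
  by rewrite ltnNge; apply/negP => /agreeW/(_ pqn).
have d_val p q : d p q = 0 \/ exists n, d p q = n.+1%:R^-1.
  by rewrite /d; case: pselect => [_|pq]; [left|right; eexists].
have d_ge0 p q : 0 <= d p q.
  by have [->|[n ->]] := d_val p q; rewrite ?invr_ge0.
exists d; split=> //.
- move=> p q; split=> [d0|->]; last by rewrite /d; case: pselect.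
  move: d0; rewrite /d; case: pselect => // pq /eqP.
  by rewrite invr_eq0 pnatr_eq0.
- move=> p q.
  have le_d p' q' : d p' q' <= d q' p'.
    have [->//|[n dE]] := d_val p' q'.
    rewrite leNgt; apply/negP; rewrite dE => /d_ltP/agreeC/d_ltP.
    by rewrite dE ltxx.
  by apply: le_anti; rewrite !le_d.
- move=> p q r; have [->|[n dE]] := d_val p r; first exact: addr_ge0.
  rewrite leNgt; apply/negP => lt_dd.
  have pq : agree n p q.
    by apply/d_ltP; rewrite -dE (le_lt_trans _ lt_dd)// lerDl.
  have qr : agree n q r.
    by apply/d_ltP; rewrite -dE (le_lt_trans _ lt_dd)// lerDr.
  by have /d_ltP := agreeT _ _ _ _ pq qr; rewrite dE ltxx.
move=> U; split=> [oU x Ux|balls].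
  have [E EU] := separating_compact_nbhs sep_u cX (open_nbhs_nbhs (conj oU Ux)).
  exists (\max_(i <- E) (pickle i).+1).+1%:R^-1; first by rewrite invr_gt0.
  move=> y /= /d_ltP xy; apply: EU => i iE; apply: xy.
  exact: (@leq_bigmax_seq _ E xpredT (fun i => (pickle i).+1)).
rewrite openE => x /balls[e e0 eU]; apply: filterS eU _.
have [n ne] : exists n : nat, n.+1%:R^-1 < e.
  exists (Num.truncn e^-1); rewrite -[ltRHS]invrK ltf_pV2 ?posrE ?invr_gt0//.
  by rewrite truncnS_gt.
have agree_nbhs m : nbhs x [set y | agree m x y].
  elim: m => [|m IH]; first by apply: filterS filterT => y _ i.
  have [[i im]|noi] := pselect (exists i : I, pickle i = m).
    apply: filterS2 IH (sep_u.1 i x) => y ag xy j.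
    rewrite ltnS leq_eqVlt => /orP[/eqP jm|/ag//].
    by rewrite (pcan_inj pickleK (etrans jm (esym im))).
  apply: filterS IH => y ag j.
  by rewrite ltnS leq_eqVlt => /orP[/eqP jm|/ag//]; case: noi; exists j.
apply: filterS (agree_nbhs n) => y /d_ltP; move=> /lt_trans; exact.
Qed.

(** * Linear complexity implies tameness *)

Lemma linear_lt_exp2 (C : nat) : exists m, (C * m + 1 < 2 ^ m)%N.
Proof.
(* 2 ^ (2 n) >= (n + 1)^2 exceeds 2 C n + 1 as soon as n >= 2 C and n > 0 *)
exists (2 * (2 * C + 1))%N; rewrite mulnC expnM -/(4 ^ _)%N.
have sq n : ((n + 1) * (n + 1) <= 4 ^ n)%N.
  by elim: n => // n; rewrite expnS; move: (4 ^ n)%N; nia.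
apply: leq_trans (sq _); nia.
Qed.

(** Suppose that the colors of x at the times in S are determined by a number
    r x <= K #|S|.  A continuous F is determined, up to an error smaller than
    b - a, by the colors at the times of a finite set E; hence r, taken for the
    m #|E| times e + g_i, decides for every i < m on which side of the gap
    ]a, b[ the value F (g_i x) can lie.  Independence asks for all 2^m choices
    of sides, more than the K m #|E| + 1 values of r. *)
Lemma linear_complexity_tame (R : realType) (G : zmodType) (X : topologicalType)
    (act : G -> X -> X) (D : Type) (col : X -> D) (K : nat) :
  compact_system act -> separating (fun g x => col (act g x)) ->
  (forall S : seq G, exists2 r : X -> nat, forall x, (r x <= K * size S)%N &
     forall x y, r x = r y ->
       forall g, g \in S -> col (act g x) = col (act g y)) ->
  tame_system R act.
Proof.
move=> sysX sepX cplx; have [cX _ [_ actD] _] := sysX.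
split=> // f cf [u [/(_ _)/cid2-/all_sig2[g _ ug] [a [b [ab indep]]]]].
have ba : 0 < b - a by rewrite subr_gt0.
have [|E Ef] := separating_compact_finite (P := fun p q => `|f p - f q| < b - a)
    sepX cX.
  move=> x; exists [set y | `|f x - f y| < (b - a) / 2].
    by have /cvgrPdist_lt := cf x; apply; rewrite divr_gt0.
  move=> p q /= xp xq; rewrite (le_lt_trans (ler_distD (f x) _ _))//.
  by rewrite (splitr (b - a)) ltrD// distrC.
have [m] := linear_lt_exp2 (K * size E); apply/negP; rewrite -leqNgt addn1.
pose S := [seq e + g i | e <- E, i <- iota 0 m].
have [r r_le rP] := cplx S.
have sizeS : size S = (size E * m)%N by rewrite size_allpairs size_iota.
pose P (B : {set 'I_m}) : set nat :=
  [set n : nat | exists2 i : 'I_m, i \in B & n = i :> nat].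
have finP B : finite_set (P B).
  by apply: (@sub_finite_set _ _ `I_m) => // _ [i _ ->] /=.
have x_ (B : {set 'I_m}) : {x | (forall i : 'I_m, i \in B -> u i x < a) /\
                 (forall i : 'I_m, i \notin B -> b < u i x)}.
  apply: cid; have [|x [xP xM]] := indep (P B) (P (~: B)%SET) (finP _) (finP _).
    rewrite -subset0 => n [[i iB ->] [j + ij]]; rewrite inE => /negP; apply.
    by rewrite -(val_inj ij).
  exists x; split=> i iB; first by apply: xP; exists i.
  by apply: xM; exists i; rewrite ?inE.
pose rank B : 'I_(K * size E * m).+1 := inord (r (sval (x_ B))).
have rank_inj : injective rank.
  move=> B B' /(congr1 val); rewrite /= !inordK ?ltnS; first last.
  - by rewrite -mulnA -sizeS.
  - by rewrite -mulnA -sizeS.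
  move=> /rP agree; apply/setP => i.
  have : `|u i (sval (x_ B)) - u i (sval (x_ B'))| < b - a.
    rewrite -!ug; apply: Ef => e eE; rewrite -!actD; apply: agree.
    by apply: allpairs_f; rewrite // mem_iota /=.
  case: (x_ B) => /= x [xB xB']; case: (x_ B') => /= y [yB yB'].
  have [iB|iB] := boolP (i \in B); have [iB'|iB'] := boolP (i \in B') => //.
    by have := xB _ iB; have := yB' _ iB'; rewrite ltr_norml; lra.
  by have := xB' _ iB; have := yB _ iB'; rewrite ltr_norml; lra.
have := leq_card _ rank_inj.
rewrite -[in X in (X <= _)%N]cardsT -powersetT card_powerset cardsT.
by rewrite !card_ord.
Qed.

(** * Oriented distance on the circle *)

Section CircleDistance.
Context {R : realType}.
Implicit Types (x y z : circle R) (t v : R).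

(** The length of the positively oriented arc from x to y.  Rotations
    preserve it, and it linearizes the circular order as seen from x. *)
Definition cdist x y : R := sval (to_circle (sval y - sval x)).

Definition cshift x t : circle R := to_circle (sval x + t).

Lemma val_to_circleD v (m : int) : 0 <= v < 1 ->
  sval (to_circle (v + m%:~R)) = v.
Proof.
move=> v01; rewrite to_circleDz.
exact: (congr1 sval (to_circle_val (exist _ v v01 : circle R))).
Qed.

Lemma val_to_circle v : 0 <= v < 1 -> sval (to_circle v) = v.
Proof. by move=> /(@val_to_circleD _ 0); rewrite addr0. Qed.

Lemma to_circle_repr v : exists m : int, v = sval (to_circle v) + m%:~R.
Proof. by exists (Num.floor v); rewrite /= subrK. Qed.

Lemma cdistE x y :
  cdist x y = if sval x <= sval y then sval y - sval x else sval y - sval x + 1.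
Proof.
have := valP x; have := valP y; rewrite /cdist; case: ifP => xy y01 x01.
  by rewrite val_to_circle//; move: xy y01 x01 => /=; lra.
rewrite -[LHS](congr1 _ (to_circleDz _ 1)) val_to_circle//.
by move: xy y01 x01; move/negbT; rewrite -ltNge /=; lra.
Qed.

Lemma cdist_ge0_lt1 x y : 0 <= cdist x y < 1.
Proof. exact: (valP (to_circle _)). Qed.

Lemma cdistxx x : cdist x x = 0.
Proof. by rewrite cdistE lexx subrr. Qed.

Lemma cdist_eq0 x y : cdist x y = 0 -> x = y.
Proof.
rewrite cdistE => xy; apply: val_inj; move: xy.
by have := valP x; have := valP y => /=; case: ifP; lra.
Qed.

Lemma cdist_gt0 x y : x <> y -> 0 < cdist x y.
Proof.
move=> xy; rewrite lt_neqAle; have /andP[-> _] := cdist_ge0_lt1 x y.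
by rewrite andbT; apply/eqP => /esym/cdist_eq0.
Qed.

Lemma cdistC x y : 0 < cdist x y -> cdist y x = 1 - cdist x y.
Proof.
have := valP x; have := valP y; rewrite !cdistE /=.
by case: (leP (sval x) (sval y)) => ?; case: (leP (sval y) (sval x)) => ?; lra.
Qed.

Lemma cdist_between x y z : cdist x y <= cdist x z ->
  cdist x z = cdist x y + cdist y z.
Proof.
have := valP x; have := valP y; have := valP z; rewrite !cdistE /=.
case: (leP (sval x) (sval y)) => ?; case: (leP (sval y) (sval z)) => ?;
  case: (leP (sval x) (sval z)) => ?; lra.
Qed.

Lemma cdist_add x y z : cdist x y + cdist y z < 1 ->
  cdist x z = cdist x y + cdist y z.
Proof.
have := valP x; have := valP y; have := valP z; rewrite !cdistE /=.
case: (leP (sval x) (sval y)) => ?; case: (leP (sval y) (sval z)) => ?;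
  case: (leP (sval x) (sval z)) => ?; lra.
Qed.

Lemma cdist_sub x y z : cdist y z <= cdist x z ->
  cdist x z = cdist x y + cdist y z.
Proof.
have := valP x; have := valP y; have := valP z; rewrite !cdistE /=.
case: (leP (sval x) (sval y)) => ?; case: (leP (sval y) (sval z)) => ?;
  case: (leP (sval x) (sval z)) => ?; lra.
Qed.

Lemma circle_orderE x y z : circle_order x y z <-> 0 < cdist x y < cdist x z.
Proof.
have := valP x; have := valP y; have := valP z.
rewrite /circle_order !cdistE /=; move: (sval x) (sval y) (sval z) => a b c.
have pos (u v w : R) : 0 < u -> 0 < v -> 0 < w -> 0 < u * v * w.
  by move=> *; rewrite !mulr_gt0.
move=> c01 b01 a01.
case: (ltgtP a b) => ab; case: (ltgtP b c) => bc; case: (ltgtP a c) => ac;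
  try subst; rewrite ?subrr ?mulr0 ?mul0r ?ltxx; try (split; by lra).
- have := pos (b - a) (c - b) (c - a); rewrite !subr_gt0 => /(_ ab bc ac).
  by split=> ?; lra.
- have := pos (b - a) (b - c) (c - a); rewrite !subr_gt0 => /(_ ab bc ac).
  by split=> ?; lra.
- have := pos (b - a) (b - c) (a - c); rewrite !subr_gt0 => /(_ ab bc ac).
  by split=> ?; lra.
- have := pos (a - b) (c - b) (c - a); rewrite !subr_gt0 => /(_ ab bc ac).
  by split=> ?; lra.
- have := pos (a - b) (c - b) (a - c); rewrite !subr_gt0 => /(_ ab bc ac).
  by split=> ?; lra.
- have := pos (a - b) (b - c) (a - c); rewrite !subr_gt0 => /(_ ab bc ac).
  by split=> ?; lra.
Qed.

Lemma cdist_to_circle t v :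
  cdist (to_circle t) (to_circle v) = sval (to_circle (v - t)).
Proof.
have [m tE] := to_circle_repr t; have [n vE] := to_circle_repr v.
rewrite /cdist; congr (sval _); rewrite -(to_circleDz _ (n - m)) intrB.
by congr to_circle; rewrite {2}tE {2}vE /=; ring.
Qed.

Lemma cdist_shift x y t : cdist (cshift x t) (cshift y t) = cdist x y.
Proof. by rewrite cdist_to_circle /cdist; congr (sval (to_circle _)); ring. Qed.

Lemma cdist_cshift x t : 0 <= t < 1 -> cdist x (cshift x t) = t.
Proof.
move=> t01; rewrite -{1}(to_circle_val x) cdist_to_circle addrC addKr.
exact: val_to_circle.
Qed.

Lemma cshiftD x t v : cshift (cshift x t) v = cshift x (t + v).
Proof.
have [m tE] := to_circle_repr (sval x + t).
by rewrite /cshift [in RHS]addrA [in RHS]tE [in RHS]addrAC to_circleDz.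
Qed.

Lemma cshift0 x : cshift x 0 = x.
Proof. by rewrite /cshift addr0 to_circle_val. Qed.

Lemma cshift_cdist x y : cshift x (cdist x y) = y.
Proof.
have [m E] := to_circle_repr (sval y - sval x).
rewrite /cshift -(to_circleDz _ m) -addrA -E addrC subrK.
exact: to_circle_val.
Qed.

End CircleDistance.

(** * Density of irrational rotations *)

Section IrrationalRotation.
Context {R : realType}.

(** Dirichlet's theorem by descent: from a positive combination s <= 1 of a
    and 1 one step of the Euclidean algorithm against 1 gives a combination that
    is at most s / 2, namely the remainder 1 - q s or its complement
    s - (1 - q s).  The coefficient of a stays nonzero, so by
    irrationality the new combination is nonzero, and the infimum of all of them
    is 0. *)
Lemma irrational_small_multiple (a e : R) : irrational a -> 0 < e ->
  exists n m : int, 0 < a *~ n + m%:~R < e.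
Proof.
move=> irr_a e0.
have mulz (n : int) : a *~ n = a * n%:~R by rewrite mulrzr.
have neq0 (n m : int) : n != 0 -> a *~ n + m%:~R != 0.
  move=> n0; apply/eqP => /eqP; rewrite addr_eq0 => /eqP anm; apply: irr_a.
  exists ((- m)%:Q / n%:Q) => //; rewrite fmorph_div/= !ratr_int intrN -anm.
  by rewrite mulz mulfK// intr_eq0.
pose S := [set s : R | 0 < s <= 1 /\
  exists n m : int, n != 0 /\ s = a *~ n + m%:~R].
have halving s : S s -> exists2 s', S s' & s' <= s / 2.
  move=> [/andP[s0 s1] [n [m [n0 sE]]]].
  have /andP[] := floor_itv s^-1; set q := Num.floor s^-1 => q_le lt_q.
  have q1 : 1 <= q by rewrite floor_ge_int// invf_ge1.
  have qs : q%:~R * s <= 1 by rewrite -ler_pdivlMr// mul1r.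
  have qs' : 1 < (q%:~R + 1) * s.
    by rewrite -ltr_pdivrMr// mul1r -[1]/(1%:~R) -intrD.
  have rE : 1 - q%:~R * s = a *~ (- q * n) + (1 - q * m)%:~R.
    by rewrite sE !mulz !(intrB, intrM, intrN); ring.
  have r'E : (q%:~R + 1) * s - 1 = a *~ ((q + 1) * n) + ((q + 1) * m - 1)%:~R.
    by rewrite sE !mulz !(intrB, intrM, intrD); ring.
  have qn0 : - q * n != 0 by rewrite mulf_neq0// oppr_eq0; lia.
  have qn0' : (q + 1) * n != 0 by rewrite mulf_neq0//; lia.
  have r0 : 1 - q%:~R * s != 0 by rewrite rE neq0.
  have {r0}r0 : 0 < 1 - q%:~R * s by rewrite lt_neqAle eq_sym r0 subr_ge0.
  have [rs|sr] := leP (1 - q%:~R * s) (s / 2).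
    exists (1 - q%:~R * s) => //; split; last by exists (- q * n), (1 - q * m).
    by lra.
  exists ((q%:~R + 1) * s - 1); last by lra.
  split; last by exists ((q + 1) * n), ((q + 1) * m - 1).
  by lra.
have S_frac : S (val (to_circle a)).
  have [m aE] := to_circle_repr a.
  have fE : val (to_circle a) = a *~ 1 + (- m)%:~R.
    by rewrite mulr1z intrN {2}aE addrK.
  split; last by exists 1, (- m).
  have /andP[f0 f1] := valP (to_circle a).
  by rewrite lt_neqAle eq_sym [X in X != 0]fE neq0//= f0 ltW.
have S_inf : has_inf S.
  split; first by exists (val (to_circle a)).
  by exists 0 => s [/andP[/ltW]].
have inf0 : inf S = 0.
  apply/eqP; rewrite eq_le; apply/andP; split; last first.
    by apply: lb_le_inf; [case: S_inf | move=> s [/andP[/ltW]]].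
  rewrite leNgt; apply/negP => inf_gt0.
  have [s Ss] := inf_adherent inf_gt0 S_inf.
  have [s' Ss'] := halving _ Ss.
  have := ge_inf S_inf.2 Ss'; lra.
have [s [/andP[s0 _] [n [m [_ sE]]]]] := inf_adherent e0 S_inf.
by rewrite inf0 add0r => se; exists n, m; rewrite -sE s0.
Qed.

Context {k : nat} {alpha : 'I_k -> circle R}.

Lemma cdist_rot (n : {ffun 'I_k -> int}) x y :
  cdist (circle_rot alpha n x) (circle_rot alpha n y) = cdist x y.
Proof. exact: cdist_shift. Qed.

Lemma circle_order_rot (n : {ffun 'I_k -> int}) x y z :
  circle_order (circle_rot alpha n x) (circle_rot alpha n y)
    (circle_rot alpha n z) <-> circle_order x y z.
Proof. by rewrite !circle_orderE !cdist_rot. Qed.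

Lemma rot_cshift (n : {ffun 'I_k -> int}) x (t : R) :
  circle_rot alpha n (cshift x t) = cshift (circle_rot alpha n x) t.
Proof. by rewrite -[LHS]/(cshift (cshift x t) _) cshiftD addrC -cshiftD. Qed.

Context (alpha_irr : exists i, irrational (sval (alpha i))).

(** The multiples of a small positive step s land in every interval longer
    than s; the integer part that accompanies the step is invisible on the
    circle. *)
Lemma rot_dense_right x y (e : R) : 0 < e ->
  exists n, 0 < cdist y (circle_rot alpha n x) < e.
Proof.
move=> e0; have [i0 irr] := alpha_irr.
have m0 : 0 < Num.min e 1 by rewrite lt_min e0 ltr01.
have [n [m]] := irrational_small_multiple irr m0.
set s := _ + _ => /andP[s0]; rewrite lt_min => /andP[se s1].
pose r := cdist x y; pose j := Num.floor (r / s) + 1.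
have /andP[] := floor_itv (r / s); rewrite -/j => j_le lt_j.
have js : r < j%:~R * s by rewrite -ltr_pdivrMr.
have js' : j%:~R * s <= r + s.
  by rewrite /j intrD mulrDl mul1r lerD2r -ler_pdivlMr.
exists [ffun i => if i == i0 then n * j else 0].
have -> : circle_rot alpha [ffun i => if i == i0 then n * j else 0] x =
    cshift x (sval (alpha i0) *~ (n * j)).
  rewrite /circle_rot /cshift (bigD1 i0)//= ffunE eqxx big1 ?addr0// => i ii0.
  by rewrite ffunE (negPf ii0).
have -> : sval (alpha i0) *~ (n * j) = j%:~R * s + (- (j * m))%:~R.
  have mulz (l : int) : sval (alpha i0) *~ l = sval (alpha i0) * l%:~R.
    by rewrite mulrzr.
  by rewrite /s !mulz intrN !intrM; ring.
suff -> : cdist y (cshift x (j%:~R * s + (- (j * m))%:~R)) = j%:~R * s - r.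
  by apply/andP; split; lra.
rewrite -{1}(cshift_cdist x y) -/r cdist_to_circle.
have -> : sval x + (j%:~R * s + (- (j * m))%:~R) - (sval x + r) =
    j%:~R * s - r + (- (j * m))%:~R by ring.
by rewrite val_to_circleD//; apply/andP; split; lra.
Qed.

Lemma rot_dense_left x y (e : R) : 0 < e ->
  exists n, 0 < cdist (circle_rot alpha n x) y < e.
Proof.
move=> e0; pose e' := Num.min e 1 / 2.
have e'0 : 0 < e' by rewrite divr_gt0// lt_min e0 ltr01.
have e'e : e' <= e / 2 by rewrite ler_pM2r ?invr_gt0// ge_min lexx.
have e'1 : e' <= 1 / 2 by rewrite ler_pM2r ?invr_gt0// ge_min lexx orbT.
have y'y : cdist (cshift y (- e')) y = e'.
  rewrite -{2}(cshift0 y) -(addNr e') -cshiftD cdist_cshift//.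
  by apply/andP; split; lra.
have [n /andP[r0 re']] := rot_dense_right x (cshift y (- e')) e'0.
exists n; have := @cdist_between _ (cshift y (- e')) (circle_rot alpha n x) y.
rewrite y'y => /(_ (ltW re')); lra.
Qed.

End IrrationalRotation.

(** * Colorings of the circle *)

(** For a coloring f, the color of the arc that ends at x or contains x in its
    interior; it differs from f x exactly when x is a cut point. *)
Definition left_limit (R : realType) (D : choiceType) (f : circle R -> D)
    (x : circle R) : D :=
  xget (f x) [set v | exists2 e, 0 < e &
    forall y, 0 < cdist y x < e -> f y = v].

Lemma left_limitE (R : realType) (D : choiceType) (f : circle R -> D) x v
    (e : R) :
  0 < e -> (forall y, 0 < cdist y x < e -> f y = v) -> left_limit f x = v.
Proof.
move=> e0 ev; rewrite /left_limit; case: xgetP => [w _ [e' e'0 e'w]|/(_ v)[]].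
  (* a distance that reaches a point of both left neighborhoods *)
  have [e1 [e1_gt0 e1_lt1 e1e e1e']] : exists e1 : R,
      [/\ 0 < e1, e1 < 1, e1 < e & e1 < e'].
    exists (Num.min (Num.min e e') 1 / 2).
    have m0 : 0 < Num.min (Num.min e e') 1 by rewrite !lt_min e0 e'0 ltr01.
    have me : Num.min (Num.min e e') 1 <= e by rewrite !ge_min lexx.
    have me' : Num.min (Num.min e e') 1 <= e' by rewrite !ge_min lexx !orbT.
    have m1 : Num.min (Num.min e e') 1 <= 1 by rewrite !ge_min lexx !orbT.
    by split; lra.
  have xe1 : cdist (cshift x (- e1)) x = e1.
    rewrite -{2}(cshift0 x) -(addNr e1) -cshiftD cdist_cshift//.
    by rewrite (ltW e1_gt0).
  by rewrite -(ev (cshift x (- e1))) ?(e'w (cshift x (- e1)))// xe1 e1_gt0.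
by exists e.
Qed.

Section Coloring.
Context {R : realType} {d : nat} {f : circle R -> 'I_d.+1}.
Context {c : 'I_d.+1 -> circle R}.
Let arc i := cint_co circle_order (c i) (c (ordS i)).
Context (d_gt0 : (1 <= d)%N) (c_inj : injective c).
Context (f_const : forall i, constant_on f (arc i)).
Context (f_diff : forall i j x y, i <> j -> arc i x -> arc j y -> f x <> f y).

Let len i := cdist (c i) (c (ordS i)).

Let ordS_neq (i : 'I_d.+1) : i <> ordS i.
Proof.
move=> /(congr1 val)/=; have := ltn_ord i; rewrite ltnS leq_eqVlt.
case/orP => [/eqP ->|id iE]; first by rewrite modnn; lia.
by move: iE; rewrite modn_small; lia.
Qed.

Let len_gt0 i : 0 < len i.
Proof. by apply: cdist_gt0 => /c_inj/ordS_neq. Qed.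

Lemma arcP i x : arc i x <-> cdist (c i) x < cdist (c i) (c (ordS i)).
Proof.
split=> [[/circle_orderE/andP[_ ]//|/= ->]|lt_x].
  by rewrite cdistxx; exact: len_gt0.
have [->|xc] := pselect (x = c i); first by right.
by left; apply/circle_orderE; rewrite lt_x andbT cdist_gt0//; exact: nesym.
Qed.

Lemma arc_c i : arc i (c i).
Proof. by right. Qed.

(** The last cut point met before x starts the arc of x. *)
Lemma arc_cover x : exists i, arc i x.
Proof.
pose i := [arg min_(i < ord0) cdist (c i) x]%O.
have i_min j : cdist (c i) x <= cdist (c j) x.
  by rewrite /i; case: arg_minP => // i' _; apply.
exists i; apply/arcP; rewrite ltNge; apply/negP => /cdist_between E.
by have := i_min (ordS i); have := len_gt0 i; rewrite /len; lra.
Qed.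

Lemma left_arc_cover x :
  exists i, 0 < cdist (c i) x <= cdist (c i) (c (ordS i)).
Proof.
have [i /arcP xi] := arc_cover x.
have [xc|xc] := pselect (c i = x); last by exists i; rewrite cdist_gt0// ltW.
exists (ord_pred i); rewrite ord_predK -xc lexx andbT.
by have := len_gt0 (ord_pred i); rewrite /len ord_predK.
Qed.

Lemma color_left_arc i x y : 0 < cdist (c i) x <= cdist (c i) (c (ordS i)) ->
  0 < cdist y x <= cdist (c i) x -> f y = f (c i).
Proof.
move=> /andP[x0 xl] /andP[y0 yx]; apply: (f_const _ (arc_c i)); apply/arcP.
by have := cdist_sub yx; lra.
Qed.

Lemma left_limit_left_arc i x :
  0 < cdist (c i) x <= cdist (c i) (c (ordS i)) -> left_limit f x = f (c i).
Proof.
move=> xi; have /andP[x0 _] := xi; apply: (left_limitE x0) => y /andP[y0 yx].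
by apply: (color_left_arc xi); rewrite y0 ltW.
Qed.

Lemma color_near_left x : exists2 e, 0 < e & forall y, 0 < cdist y x < e ->
  f y = left_limit f x /\ left_limit f y = left_limit f x.
Proof.
have [i xi] := left_arc_cover x; have /andP[x0 xl] := xi.
exists (cdist (c i) x) => // y /andP[y0 yx]; rewrite (left_limit_left_arc xi).
have E := cdist_sub (ltW yx).
split; first by apply: (color_left_arc xi); rewrite y0 ltW.
by apply: left_limit_left_arc; lra.
Qed.

Lemma color_near_right x : exists2 e, 0 < e & forall y, 0 < cdist x y < e ->
  f y = f x /\ left_limit f y = f x.
Proof.
have [i xi] := arc_cover x; have xl := (arcP i x).1 xi.
exists (cdist (c i) (c (ordS i)) - cdist (c i) x); first by rewrite subr_gt0.
move=> y /andP[y0 yx].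
have E : cdist (c i) y = cdist (c i) x + cdist x y.
  by apply: cdist_add; have := cdist_ge0_lt1 (c i) (c (ordS i)); lra.
have x0 : 0 <= cdist (c i) x by have /andP[] := cdist_ge0_lt1 (c i) x.
split; first by apply: (f_const _ xi); apply/arcP; lra.
rewrite (@left_limit_left_arc i) ?(f_const (arc_c i) xi)//; lra.
Qed.

Lemma left_limit_uncut x : (forall i, x <> c i) -> left_limit f x = f x.
Proof.
move=> xc; have [i xi] := arc_cover x; have := (arcP i x).1 xi => xl.
rewrite (@left_limit_left_arc i) ?(f_const (arc_c i) xi)//.
by rewrite cdist_gt0 ?ltW//; exact: nesym.
Qed.

Lemma left_limit_cut i : left_limit f (c i) <> f (c i).
Proof.
have E : 0 < cdist (c (ord_pred i)) (c i) <=
    cdist (c (ord_pred i)) (c (ordS (ord_pred i))).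
  have := len_gt0 (ord_pred i).
  by rewrite /len ord_predK lexx andbT.
rewrite (left_limit_left_arc E); apply: f_diff (arc_c _) (arc_c i).
by move=> ii; apply: (@ordS_neq (ord_pred i)); rewrite ord_predK.
Qed.

(** A period t would move c_0 inside its own arc, so that t is shorter than the
    arc; then the point c_1 - t lies in the arc of c_0 as well, and has the
    color of c_1. *)
Lemma coloring_aperiodic (t : R) : 0 < t < 1 -> exists s, f (cshift s t) <> f s.
Proof.
move=> /andP[t0 t1]; apply: contrapT => /forallNP per.
have {}per s : f (cshift s t) = f s by apply: contrapT; exact: per.
pose x := cshift (c ord0) t.
have xt : cdist (c ord0) x = t by rewrite cdist_cshift// ltW.
have x_arc : t < len ord0.
  have [j xj] := arc_cover x.
  suff j0 : j = ord0 by rewrite -xt; apply/arcP; rewrite -j0.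
  by apply: contrapT => /f_diff/(_ xj (arc_c _)); rewrite per.
pose y := cshift (c (ordS ord0)) (- t).
have yt : cdist y (c (ordS ord0)) = t.
  rewrite -{1}(cshift0 (c _)) -(addNr t) -cshiftD cdist_cshift//.
  by rewrite ltW.
have y_arc : arc ord0 y.
  apply/arcP; have := @cdist_sub _ (c ord0) y (c (ordS ord0)).
  by rewrite yt => /(_ (ltW x_arc)); rewrite -/(len ord0); lra.
have yc : cshift y t = c (ordS ord0) by rewrite cshiftD addNr cshift0.
have := f_diff (@ordS_neq ord0) y_arc (arc_c _).
by rewrite -yc per.
Qed.

Lemma color_const_between x y :
  (forall i, ~~ (0 < cdist x (c i) <= cdist x y)) -> f y = f x.
Proof.
move=> noc; have [i xi] := arc_cover x; have xl := (arcP i x).1 xi.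
apply: (f_const _ xi); apply/arcP.
have E := cdist_between (ltW xl).
have xS0 : 0 < cdist x (c (ordS i)) by lra.
have := noc (ordS i); rewrite xS0 /= -ltNge => yx.
rewrite (@cdist_add _ _ x); first by lra.
by have /andP[_] := cdist_ge0_lt1 (c i) (c (ordS i)); lra.
Qed.

End Coloring.

(** * Neighborhoods in the split circle *)

Section CircularOrderFacts.
Context {X : Type} {C : X -> X -> X -> Prop} (hC : circular_order C).

Lemma corder_between a p q b : C a p b -> C p q b -> C a q b.
Proof.
have [cyc _ trans _] := hC => /cyc/cyc bap pqb.
exact/cyc/(trans _ _ _ _ bap)/cyc/cyc.
Qed.

Lemma corder_split a p q b : C a p b -> C a q b -> q <> p -> C a q p \/ C p q b.
Proof.
have [cyc _ trans tot] := hC => apb aqb qp.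
have [ap _ _] := corder_neq hC apb; have [aq _ _] := corder_neq hC aqb.
have [|apq] := tot a q p aq qp ap; first by left.
by right; apply/cyc/cyc/(trans _ _ _ _ (cyc _ _ _ aqb))/cyc/cyc.
Qed.

End CircularOrderFacts.

Section SplitTopology.
Context {R : realType} {A : set (circle R)}.
Implicit Types (p q r : split_circle A) (x y : circle R).
Local Notation pr := (@split_proj R A).
Local Notation C := (split_order A).

Definition is_minus p := if p is Minus _ _ then true else false.
Definition is_plus p := if p is Plus _ _ then true else false.

Lemma split_eqP p q : pr p = pr q -> is_minus p = is_minus q -> p = q.
Proof.
case: p => x hx; case: q => y hy //= xy _; subst y => //;
  by rewrite (Prop_irrelevance hx hy).
Qed.

Lemma split_jumpP p q r : split_jump p q r <->
  [/\ pr p = pr q, is_minus p, is_plus q & pr r <> pr p].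
Proof.
split=> [[a [Aa [-> -> rm rp]]]|[]].
  split=> //= ra; case: r rm rp ra => x hx /= + + xa; subst x => //;
    by rewrite (Prop_irrelevance hx Aa).
case: p => // a Aa; case: q => // b Ab /= ab _ _ ra; subst b; exists a, Aa.
by rewrite (Prop_irrelevance Ab Aa); split=> // rE; apply: ra; rewrite rE.
Qed.

Lemma split_order_circle p q r :
  0 < cdist (pr p) (pr q) < cdist (pr p) (pr r) -> C p q r.
Proof. by move/circle_orderE; left. Qed.

Let proj_neq p q : 0 < cdist (pr p) (pr q) -> pr p <> pr q.
Proof. by move=> + E; rewrite E cdistxx ltxx. Qed.

(** The interval topology is generated by one-sided arcs of the circle: to the
    right of p unless p = a^-, whose immediate successor is a^+, and to the left
    of p unless p = a^+.  All topological facts about the split circle are read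
    off from this description. *)
Lemma split_nbhsP p (U : set (split_circle A)) : nbhs p U <-> [/\ U p,
  ~~ is_minus p -> exists2 e, 0 < e &
    forall q, 0 < cdist (pr p) (pr q) < e -> U q &
  ~~ is_plus p -> exists2 e, 0 < e &
    forall q, 0 < cdist (pr q) (pr p) < e -> U q].
Proof.
have [cyc asym trans tot] := @split_circular_order R A.
have co := @split_circular_order R A.
split.
  rewrite nbhsE => -[B [oB Bp] BU]; have [a [b [ab apb abB]]] := oB p Bp.
  rewrite /cint_oo /= in apb; have [ap pb _] := corder_neq co apb.
  split; first exact: BU.
  (* over the same point p = x^+ and b = x^-, but x^+ follows x^-, so that no
     interval ending at x^- contains x^+ *)
  - move=> nm; have pb' : pr p <> pr b.
      move=> E; have mp : is_minus p != is_minus b.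
        by apply/eqP => /(split_eqP E).
      have [mb pp] : is_minus b /\ is_plus p.
        move: p b E nm mp {apb ap pb abB ab oB Bp}.
        by move=> [x nx|x Ax|x Ax] [y ny|y Ay|y Ay] //= xy; subst y.
      have bpa : C b p a.
        right; apply: Or31; apply/split_jumpP; split=> // aE.
        have [am|am] := boolP (is_minus a).
          by apply: ab; apply: split_eqP; rewrite ?mb.
        apply: ap; apply: split_eqP; first by rewrite aE.
        by rewrite (negPf am) (negPf nm).
      by apply: (asym _ _ _ (cyc _ _ _ apb)); exact: cyc.
    exists (cdist (pr p) (pr b)); first exact: cdist_gt0.
    move=> q /split_order_circle pqb; apply/BU/abB.
    exact (corder_between co apb pqb).
  - move=> np; have ap' : pr a <> pr p.
      move=> E; have mp : is_minus p != is_minus a.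
        by apply/eqP => /esym/(split_eqP E).
      have [ma pp] : is_minus p /\ is_plus a.
        move: p a E np mp {apb ap pb abB ab oB Bp}.
        by move=> [x nx|x Ax|x Ax] [y ny|y Ay|y Ay] //= xy; subst y.
      have pab : C p a b.
        right; apply: Or31; apply/split_jumpP; split=> // bE.
        have [bm|bm] := boolP (is_minus b).
          by apply: pb; apply: split_eqP; rewrite ?ma.
        apply: ab; apply: split_eqP; first by rewrite bE.
        by rewrite (negPf bm); case: (a) pp.
      by apply: (asym _ _ _ apb); exact: cyc.
    exists (cdist (pr a) (pr p)); first exact: cdist_gt0.
    move=> q qp; apply/BU/abB; refine (trans _ _ _ _ _ apb).
    apply: split_order_circle.
    by have := cdist_sub (ltW (andP qp).2); lra.
move=> [Up right_U left_U].
(* arcs shorter than 1/2 on the two sides of p together form one arc *)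
have small (e : R) : 0 < e -> exists e', [/\ 0 < e', e' < e & e' < 1 / 2].
  move=> e0; have m0 : 0 < Num.min e 1 by rewrite lt_min e0 ltr01.
  have me : Num.min e 1 <= e by rewrite ge_min lexx.
  have m1 : Num.min e 1 <= 1 by rewrite ge_min lexx orbT.
  by exists (Num.min e 1 / 3); split; lra.
have [b [pb bE bU]] : exists b, [/\ p <> b,
    (is_minus p /\ is_plus b /\ pr p = pr b) \/
    (~~ is_minus p /\ 0 < cdist (pr p) (pr b) < 1 / 2) &
    forall q, C p q b -> U q].
  have [mp|mp] := boolP (is_minus p).
    have [b [bp Eb]] : exists b, is_plus b /\ pr p = pr b.
      by case: p mp {Up right_U left_U} => // a Aa _; exists (Plus Aa).
    have pb : p <> b by move=> E; rewrite E in mp; case: (b) mp bp.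
    exists b; split=> //; first by left.
    move=> q pqb; exfalso; apply: (asym _ _ _ pqb); right; apply: Or31.
    apply/split_jumpP; split=> // qE.
    have [pq qb _] := corder_neq co pqb.
    have [qm|qm] := boolP (is_minus q).
      by apply: pq; apply: split_eqP; rewrite // mp qm.
    apply: qb; apply: split_eqP; first by rewrite qE.
    by rewrite (negPf qm); case: (b) bp.
  have [e /small[e' [e'0 e'e e'1]] eU] := right_U mp.
  have [b Eb] := @split_lift R A (cshift (pr p) e').
  have pbE : cdist (pr p) (pr b) = e'.
    by rewrite Eb cdist_cshift//; apply/andP; split; lra.
  have pb : pr p <> pr b by apply: proj_neq; rewrite pbE.
  exists b; split; first by move=> E; apply: pb; rewrite E.
    by right; rewrite pbE e'0 e'1.
  move=> q [/circle_orderE qE|]; first by apply: eU; lra.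
  case=> /split_jumpP[E1 E2 _ _]; first by rewrite E2 in mp.
    by apply: eU; rewrite E1; lra.
  by case: pb.
have [a [ap aE aU]] : exists a, [/\ a <> p,
    (is_plus p /\ is_minus a /\ pr a = pr p) \/
    (~~ is_plus p /\ 0 < cdist (pr a) (pr p) < 1 / 2) &
    forall q, C a q p -> U q].
  have [pp|pp] := boolP (is_plus p).
    have [a [am Ea]] : exists a, is_minus a /\ pr a = pr p.
      by case: (p) pp => // a Aa _; exists (Minus Aa).
    have ap : a <> p by move=> E; rewrite E in am; case: (p) pp am.
    exists a; split=> //; first by left.
    move=> q aqp; exfalso; apply: (asym _ _ _ aqp); right; apply: Or31.
    apply/split_jumpP; split=> // qE.
    have [aq qp _] := corder_neq co aqp.
    have [qm|qm] := boolP (is_minus q).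
      by apply: aq; apply: split_eqP; rewrite // am qm.
    apply: qp; apply: split_eqP; first by rewrite qE.
    by rewrite (negPf qm); case: (p) pp.
  have [e /small[e' [e'0 e'e e'1]] eU] := left_U pp.
  have [a Ea] := @split_lift R A (cshift (pr p) (- e')).
  have apE : cdist (pr a) (pr p) = e'.
    rewrite Ea -{2}(cshift0 (pr p)) -(addNr e') -cshiftD cdist_cshift//.
    by apply/andP; split; lra.
  have ap : pr a <> pr p by apply: proj_neq; rewrite apE.
  exists a; split; first by move=> E; apply: ap; rewrite E.
    by right; rewrite apE e'0 e'1.
  move=> q [/circle_orderE qE|].
    by apply: eU; have := cdist_between (ltW (andP qE).2); lra.
  case=> /split_jumpP[E1 E2 E3 _]; first by apply: eU; rewrite -E1; lra.
    by rewrite E3 in pp.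
  by case: ap.
have apb : C a p b.
  case: aE => [[pp [am Ea]]|[pp ad]].
    case: bE => [[pm _]|[_ bd]]; first by case: (p) pp pm.
    right; apply: Or31; apply/split_jumpP; split=> //; rewrite Ea.
    by apply: nesym; apply: proj_neq; lra.
  case: bE => [[pm [bp Eb]]|[_ bd]].
    right; apply: Or32; apply/split_jumpP; split=> //.
    by apply: proj_neq; lra.
  by apply: split_order_circle; rewrite (@cdist_add _ _ (pr p) (pr b)); lra.
have oab : cinterval_open C (cint_oo C a b).
  by move=> q aqb; exists a, b; split=> //; have [] := corder_neq co apb.
rewrite nbhsE; exists (cint_oo C a b); first exact (conj oab apb).
move=> q aqb; have [->//|qp] := pselect (q = p).
by have [/aU|/bU] := corder_split co apb aqb qp.
Qed.

End SplitTopology.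

(** * The split circle as a dynamical system *)

(** The circle is [0, 1] with its endpoints glued; the value t = 1 is allowed
    because a limit of representatives may be 1. *)
Lemma cdist_near (R : realType) (t e : R) (y : circle R) : 0 <= t <= 1 ->
  `|sval y - t| < e ->
  cdist (to_circle t) y < e \/ cdist y (to_circle t) < e.
Proof.
move=> t01; have := valP y => /= y01.
have E1 : cdist (to_circle t) y = sval (to_circle (sval y - t)).
  by rewrite -{1}(to_circle_val y) cdist_to_circle.
have E2 : cdist y (to_circle t) = sval (to_circle (t - sval y)).
  by rewrite -{1}(to_circle_val y) cdist_to_circle.
rewrite ltr_norml => /andP[te et].
have [ty|yt] := leP t (sval y).
  left; rewrite E1 val_to_circle//.
  by apply/andP; split; lra.
right; rewrite E2; have [t_lt|t_ge] := ltP (t - sval y) 1.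
  by rewrite val_to_circle; lra.
have -> : t - sval y = 0 + 1%:~R by lra.
by rewrite val_to_circleD; lra.
Qed.

Section SplitCompact.
Context {R : realType} {A : set (circle R)}.
Local Notation pr := (@split_proj R A).

(** Let x be the limit on the circle of an ultrafilter.  Over an uncut x the
    convergence lifts.  Over a cut x the ultrafilter contains either the set
    formed by x^+ and the half circle on its right, or the complement, and
    converges to x^+ or to x^- accordingly. *)
Lemma split_compact : compact [set: split_circle A].
Proof.
rewrite compact_ultra => F FU _.
have FF : ProperFilter F by exact: ultra_proper.
pose g (p : split_circle A) : R := sval (pr p).
have F01 : F (g @^-1` `[0, 1]).
  apply: filterS filterT => p _ /=; rewrite in_itv /=.
  by have /andP[-> /ltW] := valP (pr p).
have [t [t01 clt]] := @segment_compact R 0 1 _ (fmap_proper_filter g FF) F01.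
move: t01; rewrite /= in_itv /= => t01; pose x := to_circle t.
have near_x (e : R) : 0 < e ->
    F [set p | cdist x (pr p) < e \/ cdist (pr p) x < e].
  move=> e0.
  have [|Fn] := in_ultra_setVsetC [set p | `|g p - t| < e] FU.
    by apply: filterS => p; exact: cdist_near.
  have [||s [/= nse se]] :=
    clt (~` [set s | `|s - t| < e]) [set s | `|s - t| < e].
  - exact: Fn.
  - apply: filterS (nbhsx_ballx t e e0) => s; rewrite /ball /= => st.
    by rewrite distrC.
  - by case: nse.
have [Ax|nAx] := pselect (A x); last first.
  exists (Uncut nAx); split=> // U /split_nbhsP[Ux].
  move=> /(_ isT)[e1 e1_gt0 U1] /(_ isT)[e2 e2_gt0 U2].
  have m0 : 0 < Num.min e1 e2 by rewrite lt_min e1_gt0.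
  apply: filterS (near_x _ m0) => p.
  have [xp|xp] := pselect (x = pr p).
    move=> _; suff -> : p = Uncut nAx by [].
    apply: split_eqP; first by rewrite -xp.
    by case: (p) xp => // a Aa /= E; exfalso; move: Aa; rewrite -E.
  rewrite /= !lt_min; case=> /andP[p1 p2]; [apply: U1|apply: U2].
    by rewrite /= cdist_gt0.
  by rewrite /= cdist_gt0//; exact: nesym.
pose right_side := [set p | p = Plus Ax \/ 0 < cdist x (pr p) < 1 / 2].
have far (p : split_circle A) : cdist x (pr p) < 1 / 2 -> x <> pr p ->
    ~ (cdist (pr p) x < 1 / 2).
  by move=> h1 /cdist_gt0 h2; rewrite (cdistC h2); lra.
have min0 (e : R) : 0 < e -> 0 < Num.min e (1 / 2).
  by move=> e0; rewrite lt_min e0 divr_gt0.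
have [FR|FL] := in_ultra_setVsetC right_side FU.
  exists (Plus Ax); split=> // U /split_nbhsP[Up /(_ isT)[e e0 Ue] _].
  apply: filterS2 FR (near_x _ (min0 e e0)) => p [->//|/andP[p0 p2]].
  rewrite /= !lt_min => -[/andP[pe _]|/andP[_ pe]].
    by apply: Ue; rewrite /= p0.
  by exfalso; move: pe; apply: far => // E; rewrite E cdistxx ltxx in p0.
exists (Minus Ax); split=> // U /split_nbhsP[Up _ /(_ isT)[e e0 Ue]].
apply: filterS2 FL (near_x _ (min0 e e0)) => p /not_orP[np Lp].
have [xp|xp] := pselect (x = pr p).
  move=> _; suff -> : p = Minus Ax by [].
  apply: split_eqP; first by rewrite -xp.
  case: (p) np xp => // a Aa /= np E; exfalso; first by apply: (Aa); rewrite -E.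
  by apply: np; apply: split_eqP; rewrite /= ?E.
rewrite /= !lt_min => -[/andP[_ pe]|/andP[pe _]].
  by exfalso; apply: Lp; rewrite pe cdist_gt0.
by apply: Ue; rewrite /= pe cdist_gt0//; exact: nesym.
Qed.

End SplitCompact.

Section SplitSystem.
Context {R : realType} {k : nat} {alpha : 'I_k -> circle R}.
Context {A : set (circle R)} (invA : rot_invariant alpha A).
Local Notation pr := (@split_proj R A).

Lemma split_proj_act n p : pr (split_act invA n p) = circle_rot alpha n (pr p).
Proof. by case: p. Qed.

Lemma is_minus_act n p : is_minus (split_act invA n p) = is_minus p.
Proof. by case: p. Qed.

Lemma is_plus_act n p : is_plus (split_act invA n p) = is_plus p.
Proof. by case: p. Qed.

Lemma split_act_is_action : is_action (split_act invA).
Proof.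
have [act0 actD] := rot_action alpha.
split=> [p|m n p]; apply: split_eqP; rewrite ?is_minus_act// !split_proj_act.
  exact: act0.
exact: actD.
Qed.

Lemma split_act_continuous n : continuous (split_act invA n).
Proof.
move=> p U /split_nbhsP[Up right_U left_U]; apply/split_nbhsP; split=> //.
- rewrite -(is_minus_act n) => /right_U[e e0 Ue]; exists e => // q pq.
  by apply: Ue; rewrite !split_proj_act cdist_rot.
- rewrite -(is_plus_act n) => /left_U[e e0 Ue]; exists e => // q pq.
  by apply: Ue; rewrite !split_proj_act cdist_rot.
Qed.

Lemma split_act_order n p q r : split_order A p q r ->
  split_order A (split_act invA n p) (split_act invA n q) (split_act invA n r).
Proof.
have jump u v w : split_jump u v w -> split_jump (split_act invA n u)
    (split_act invA n v) (split_act invA n w).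
  move=> /split_jumpP[uv mu pv wu]; apply/split_jumpP.
  rewrite !split_proj_act is_minus_act is_plus_act uv; split=> // E.
  apply: wu; apply: cdist_eq0; rewrite uv -(cdist_rot (alpha := alpha) n).
  by rewrite E cdistxx.
case=> [pqr|pqr].
  by left; rewrite !split_proj_act; apply/circle_order_rot.
by right; case: pqr => /jump; [exact: Or31|exact: Or32|exact: Or33].
Qed.

Lemma split_circularly_ordered :
  circularly_ordered_by (split_order A) (split_act invA).
Proof.
have co := @split_circular_order R A; have [_ asym _ _] := co.
have [act0 actD] := split_act_is_action.
split=> // n; split=> [p q r pqr _ _ _|p q]; first exact: split_act_order.
move=> /(congr1 (split_act invA (- n))); rewrite -!actD addNr !act0 => <-.
left; have cc_p x : cint_cc (split_order A) p p x -> x = p.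
  by case=> [/(corder_neq co)[_ _ /(_ erefl)]//|[]].
by move=> x y /cc_p -> /cc_p ->.
Qed.

(** An open set contains an arc on one side of each of its points, and orbits
    in the circle enter such arcs. *)
Lemma split_minimal (alpha_irr : exists i, irrational (sval (alpha i))) :
  minimal (split_act invA).
Proof.
move=> p U [q Uq] oU.
have /split_nbhsP[_ right_U left_U] : nbhs q U by exact: open_nbhs_nbhs.
have [mq|mq] := boolP (is_minus q).
  have [|e e0 Ue] := left_U; first by case: (q) mq.
  have [n nq] := rot_dense_left alpha_irr (pr p) (pr q) e0.
  exists (split_act invA n p); split; last by exists n.
  by apply: Ue; rewrite split_proj_act.
have [e e0 Ue] := right_U mq.
have [n nq] := rot_dense_right alpha_irr (pr p) (pr q) e0.
exists (split_act invA n p); split; last by exists n.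
by apply: Ue; rewrite split_proj_act.
Qed.

End SplitSystem.

(** * Orbit closures in the full shift *)

Section Shift.
Context {G : zmodType} {D : choiceType}.
Local Notation shift := (@full_shift G D).

Lemma shift_coord_nbhs (t : G) (w : shift) :
  nbhs w [set w' : shift | w' t = w t].
Proof.
have := @proj_continuous G (fun=> discrete_topology D) t w.
by move=> /(_ [set w t]); apply; exact: discrete_set1.
Qed.

Lemma shift_cylinder_nbhs (S : seq G) (w : shift) :
  nbhs w [set w' : shift | forall t, t \in S -> w t = w' t].
Proof.
elim: S => [|s S IH]; first by apply: filterS filterT.
apply: filterS2 IH (shift_coord_nbhs s w) => w' /= wS ws t.
by rewrite inE => /orP[/eqP ->|/wS].
Qed.

Lemma shift_hausdorff : hausdorff_space shift.
Proof.
apply: (@separating_hausdorff _ _ _ (fun (t : G) (w : shift) => w t)).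
split=> [t w|w w' ww']; first exact: shift_coord_nbhs.
exact: funext.
Qed.

Lemma shift_continuous_coord (X : topologicalType) (h : X -> shift) :
  (forall t x, nbhs x [set y | h y t = h x t]) -> continuous h.
Proof.
move=> h_coord x; apply/cvg_sup => t.
have FF : Filter (h @ nbhs x) by exact: fmap_filter.
move=> U [_ [[B oB <-] Bx BU]].
by apply: filterS (h_coord t x) => y /= hyx; apply: BU; rewrite /= hyx.
Qed.

Context (phi : G -> D).
Local Notation X := (set_type (orbit_closure phi)).

Lemma orbit_closure_pattern (w : X) (S : seq G) :
  exists n, forall t, t \in S -> (set_val w : shift) t = phi (t + n).
Proof.
have [_ [[n _ <-] wn]] := set_valP w _ (shift_cylinder_nbhs S (set_val w)).
by exists n.
Qed.

Lemma orbit_closure_act0 (g : G) (w : X) :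
  (set_val (orbit_closure_act g w) : shift) 0 = (set_val w : shift) g.
Proof. by rewrite -[LHS]/((set_val w : shift) (0 + g)) add0r. Qed.

Lemma set_val_nbhs (w : X) (U : set shift) : nbhs (set_val w : shift) U ->
  nbhs w (set_val @^-1` U).
Proof. exact: (@initial_continuous _ _ set_val). Qed.

Lemma orbit_closure_separating : separating (fun (g : G) (w : X) =>
  (set_val (orbit_closure_act g w) : shift) 0).
Proof.
split=> [g w|w w' ww'].
  apply: filterS (set_val_nbhs (shift_coord_nbhs g (set_val w))) => w' ww'.
  by rewrite /= !orbit_closure_act0.
apply: val_inj; apply: funext => g.
by have := ww' g; rewrite !orbit_closure_act0.
Qed.

Lemma orbit_closure_continuous (Y : topologicalType) (h : Y -> X) :
  (forall t x, nbhs x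
     [set y | (set_val (h y) : shift) t = (set_val (h x) : shift) t]) ->
  continuous h.
Proof.
move=> h_coord x.
have /(_ x) c := @shift_continuous_coord Y (set_val \o h) h_coord.
move=> U [_ [[B oB <-] Bx BU]].
exact: (@filterS _ (h @ nbhs x) _ _ _ BU (c B (open_nbhs_nbhs (conj oB Bx)))).
Qed.

Lemma orbit_closure_is_action : is_action (@orbit_closure_act G D phi).
Proof.
split=> [w|g h w]; apply: val_inj; apply: funext => t; rewrite /= /shift_act.
  by rewrite addr0.
by rewrite addrA.
Qed.

Lemma orbit_closure_act_continuous g :
  continuous (@orbit_closure_act G D phi g).
Proof.
apply: orbit_closure_continuous => t w.
exact: set_val_nbhs (shift_coord_nbhs (t + g) (set_val w)).
Qed.

Definition orbit_point (g : G) : X :=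
  SigSub (mem_set
    (subset_closure (imageT (fun g => shift_act g (phi : shift)) g))).

Lemma orbit_point_dense : dense (range orbit_point).
Proof.
move=> U [w Uw] [B oB UE]; have Bw : B (set_val w) by rewrite -UE in Uw.
have [_ [[n _ <-] wn]] := set_valP w _ (open_nbhs_nbhs (conj oB Bw)).
by exists (orbit_point n); split; [rewrite -UE|exists n].
Qed.

Lemma orbit_closure_system : compact [set: X] ->
  compact_system (@orbit_closure_act G D phi).
Proof.
move=> cX; split=> //.
- exact: separating_hausdorff orbit_closure_separating.
- exact: orbit_closure_is_action.
- exact: orbit_closure_act_continuous.
Qed.

(** The system witnessing tameness of v o phi is the orbit closure itself, with
    the evaluation at 0. *)
Lemma orbit_closure_tame_function (R : realType) (v : D -> R) (B : R) :
  (forall a, `|v a| <= B) -> tame_system R (@orbit_closure_act G D phi) ->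
  tame_function (v \o phi).
Proof.
move=> vB tameX; split; first by exists B => g; exact: vB.
exists X, (@orbit_closure_act G D phi), orbit_point,
  (fun w => v ((set_val w : shift) 0)).
split=> //.
- move=> g h; apply: val_inj; apply: funext => t.
  by rewrite /= /shift_act addrA.
- exact: orbit_point_dense.
- move=> w U Uw; apply: filterS (set_val_nbhs (shift_coord_nbhs 0 (set_val w))).
  by move=> w' /= ww'; rewrite /= ww'; exact: nbhs_singleton.
- by move=> g; congr (v (phi _)); rewrite add0r.
Qed.

End Shift.

(** * Coding by itineraries *)

Section SplitColor.
Context {R : realType} {k d : nat} {alpha : 'I_k -> circle R}.
Context {f : circle R -> 'I_d.+1} {c : 'I_d.+1 -> circle R}.
Let arc i := cint_co circle_order (c i) (c (ordS i)).
Context (d_gt0 : (1 <= d)%N) (c_inj : injective c).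
Context (f_const : forall i, constant_on f (arc i)).
Context (f_diff : forall i j x y, i <> j -> arc i x -> arc j y -> f x <> f y).

(** The color on the side of the circle to which p belongs: the left side for
    a^-, the right side for a^+, either one for an uncut point. *)
Definition split_color (A : set (circle R)) (p : split_circle A) : 'I_d.+1 :=
  if is_minus p then left_limit f (split_proj p) else f (split_proj p).

(** This is where f has to be split at every cut point: at an unsplit point
    the colors on the left and on the right must agree. *)
Lemma split_color_nbhs (A : set (circle R)) : (forall i, A (c i)) ->
  forall p : split_circle A, nbhs p [set q | split_color q = split_color p].
Proof.
move=> Ac p; apply/split_nbhsP; split=> // [mp|pp].
  have [e e0 fe] := color_near_right d_gt0 c_inj f_const (split_proj p).
  exists e => // q /fe[fq lq]; rewrite /= /split_color (negPf mp).
  by case: ifP.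
have [e e0 fe] := color_near_left d_gt0 c_inj f_const (split_proj p).
exists e => // q /fe[fq lq]; rewrite /= /split_color.
have -> : (if is_minus p then left_limit f (split_proj p) else f (split_proj p))
    = left_limit f (split_proj p).
  case: p pp {fq lq fe} => // x nAx _ /=.
  rewrite (left_limit_uncut d_gt0 c_inj f_const)// => i xc.
  by apply: nAx; rewrite xc.
by case: ifP.
Qed.

Definition cut_orbit : set (circle R) :=
  [set x | exists n i, x = circle_rot alpha n (c i)].

Lemma cut_orbit_c i : cut_orbit (c i).
Proof. by exists 0, i; have [-> _] := rot_action alpha. Qed.

Lemma cut_orbit_invariant : rot_invariant alpha cut_orbit.
Proof.
have [_ actD] := rot_action alpha.
by move=> n _ [m [i ->]]; exists (n + m), i; rewrite actD.
Qed.

Local Notation act := (split_act cut_orbit_invariant).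

Context (alpha_irr : exists i, irrational (sval (alpha i))).

(** For points over distinct x and y, the density of the orbits brings x just
    to the right of any prescribed s, and y at the same moment just to the right
    of s + (y - x); one-sided constancy of f then turns equality of the
    itineraries into a period of f. *)
Lemma split_itinerary_separating :
  separating (fun n (p : split_circle cut_orbit) => split_color (act n p)).
Proof.
have [act0 actD] := split_act_is_action cut_orbit_invariant.
split=> [n p|p q pq].
  exact (split_act_continuous (split_color_nbhs cut_orbit_c (act n p))).
have [E|neq] := pselect (split_proj p = split_proj q).
  (* one of p, q is a^- and the other a^+; some n moves c_i to a *)
  apply: split_eqP => //; apply: contrapT => mpq.
  have [n [i pE]] : cut_orbit (split_proj p).
    case: p q E mpq {pq} => [x nAx|//|//] [y nAy|y Ay|y Ay] //= xy.
    by case: nAx; rewrite xy.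
  have prE r : split_proj r = split_proj p -> split_proj (act (- n) r) = c i.
    have [ract0 ractD] := rot_action alpha.
    by move=> rp; rewrite split_proj_act rp pE -ractD addNr ract0.
  have := pq (- n); rewrite /split_color !is_minus_act !prE//.
  have := left_limit_cut d_gt0 c_inj f_const f_diff (i := i).
  by move: mpq; case: (is_minus p); case: (is_minus q) => // _ + h; rewrite ?h.
exfalso; pose t := cdist (split_proj p) (split_proj q).
have t01 : 0 < t < 1.
  rewrite cdist_gt0//.
  by have /andP[_ ->] := cdist_ge0_lt1 (split_proj p) (split_proj q).
have [s] := coloring_aperiodic d_gt0 c_inj f_diff t01; apply.
have [e e0 fe] := color_near_right d_gt0 c_inj f_const s.
have [e' e'0 fe'] := color_near_right d_gt0 c_inj f_const (cshift s t).
have m0 : 0 < Num.min e e' by rewrite lt_min e0.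
(* the same n serves q, as rotations preserve the distance t *)
have [n] := rot_dense_right alpha_irr (split_proj p) s m0.
rewrite lt_min => /andP[n0 /andP[ne ne']].
have color_p : split_color (act n p) = f s.
  rewrite /split_color split_proj_act.
  by have [|-> ->] := fe (circle_rot alpha n (split_proj p));
    [rewrite n0|case: ifP].
have color_q : split_color (act n q) = f (cshift s t).
  rewrite /split_color split_proj_act.
  have [|-> ->] := fe' (circle_rot alpha n (split_proj q)); last by case: ifP.
  have -> : circle_rot alpha n (split_proj q) =
      cshift (circle_rot alpha n (split_proj p)) t.
    by rewrite -rot_cshift cshift_cdist.
  by rewrite cdist_shift n0.
by rewrite -color_p -color_q; exact/esym/pq.
Qed.

(** The coding reads f itself, so a point z of A has to be lifted to z^+. *)
Lemma split_color_coding (z : circle R) : exists p : split_circle cut_orbit,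
  forall n, split_color (act n p) = coding alpha f z n.
Proof.
have [p [pz mp]] : exists p : split_circle cut_orbit,
    split_proj p = z /\ ~~ is_minus p.
  have [Az|nAz] := pselect (cut_orbit z); first by exists (Plus Az).
  by exists (Uncut nAz).
exists p => n.
by rewrite /split_color is_minus_act (negPf mp) split_proj_act pz.
Qed.

(** The range of the itinerary map is closed, by compactness, and contains the
    orbit of phi; it is no larger than the orbit closure because the orbit of
    the lift of z is dense in the split circle. *)
Lemma orbit_closure_isomorphic (z : circle R) :
  compact [set: set_type (orbit_closure (coding alpha f z))] /\
  isomorphic (orbit_closure_act (phi := coding alpha f z)) act.
Proof.
set phi := coding alpha f z; pose T := split_circle cut_orbit.
have [act0 actD] := split_act_is_action cut_orbit_invariant.
have sep := split_itinerary_separating.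
have cT : compact [set: T] by exact: split_compact.
pose h (p : T) : @full_shift {ffun 'I_k -> int} 'I_d.+1 :=
  fun n => split_color (act n p).
have h_cont : continuous h by apply: shift_continuous_coord; exact: sep.1.
have h_act g p : h (act g p) = shift_act g (h p).
  by apply: funext => n; rewrite /h /shift_act actD.
have h_inj p q : h p = h q -> p = q.
  by move=> hpq; apply: sep.2 => n; exact: (congr1 (@^~ n) hpq).
have [p0 p0E] := split_color_coding z.
have hp0 : h p0 = phi by apply: funext.
have h_orbit p : orbit_closure phi (h p).
  move=> U /h_cont; rewrite nbhsE => -[V [oV Vp] VU].
  have [q [Vq [n _ qE]]] :=
    split_minimal cut_orbit_invariant alpha_irr p0 (ex_intro _ p Vp) oV.
  exists (h q); split; last exact: VU.
  by exists n => //; rewrite -hp0 -h_act qE.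
have h_surj w : orbit_closure phi w -> exists p, h p = w.
  have hT_closed : closed (h @` [set: T]).
    apply: compact_closed; first exact: shift_hausdorff.
    by apply: continuous_compact => //; exact: continuous_subspaceT.
  move=> phi_w; have [|p _ hp] := hT_closed w; last by exists p.
  apply: closureS phi_w => _ [n _ <-]; exists (act n p0) => //.
  by rewrite h_act hp0.
pose X := set_type (orbit_closure phi).
pose hX (p : T) : X := SigSub (mem_set (h_orbit p)).
have /choice[hX' hXK] : forall w : X, exists p, hX p = w.
  move=> w; have [p hp] := h_surj _ (set_valP w).
  by exists p; apply: val_inj.
have hX_cont : continuous hX.
  by apply: orbit_closure_continuous; exact: sep.1.
have hXK' : cancel hX hX'.
  by move=> p; apply: h_inj; exact: (congr1 val (hXK (hX p))).
split.
  have -> : [set: X] = hX @` [set: T].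
    by apply/seteqP; split=> // w _; exists (hX' w).
  by apply: continuous_compact => //; exact: continuous_subspaceT.
exists hX', hX; split=> //; last first.
  move=> g w; apply: h_inj; rewrite h_act.
  have hE v : h (hX' v) = set_val v by exact: (congr1 val (hXK v)).
  by rewrite !hE.
move=> w U wU.
have [E EU] := separating_compact_nbhs sep cT wU.
apply: filterS (set_val_nbhs (shift_cylinder_nbhs E (set_val w))) => w' /= ww'.
have hE v : h (hX' v) = set_val v by exact: (congr1 val (hXK v)).
by apply: EU => n nE; rewrite -!/(h _ n) !hE; exact: ww'.
Qed.

(** The number r x of points c_i - s in [0, x] determines the pattern seen from
    x: between two points with the same number nothing is crossed. *)
Lemma coding_complexity (S : seq {ffun 'I_k -> int}) :
  exists2 r : circle R -> nat, forall x, (r x <= d.+1 * size S)%N &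
    forall x y, r x = r y -> forall n, n \in S ->
      f (circle_rot alpha n x) = f (circle_rot alpha n y).
Proof.
have [ract0 ractD] := rot_action alpha.
pose P := [seq sval (circle_rot alpha (- n) (c i)) | n <- S, i <- enum 'I_d.+1].
exists (fun x => count (fun s => s <= sval x) P).
  move=> x; rewrite (leq_trans (count_size _ _))//.
  by rewrite size_allpairs size_enum_ord mulnC.
have mono (x y : circle R) : sval x <= sval y ->
    count (fun s => s <= sval x) P = count (fun s => s <= sval y) P ->
    forall n, n \in S -> f (circle_rot alpha n y) = f (circle_rot alpha n x).
  move=> xy rxy n nS.
  have no_cut : ~~ has (fun s => sval x < s <= sval y) P.
    rewrite has_count -eqn0Ngt; apply/eqP.
    have := count_predUI (fun s => s <= sval x)
      (fun s => sval x < s <= sval y) P.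
    rewrite [X in (_ + X)%N](eq_count (a2 := pred0)); last first.
      by move=> s /=; case: (leP s (sval x)).
    rewrite count_pred0 addn0.
    rewrite [LHS](eq_count (a2 := fun s => s <= sval y)); last first.
      by move=> s /=; case: (leP s (sval x)) => //= sx; rewrite (le_trans sx).
    by rewrite rxy; lia.
  apply: (color_const_between d_gt0 c_inj f_const) => i; apply: contra no_cut.
  rewrite cdist_rot -(ract0 (c i)) -(addrN n) ractD cdist_rot => x_cut.
  (* as x <= y in [0, 1), the oriented arc from x to y does not wrap around *)
  apply/hasP; exists (sval (circle_rot alpha (- n) (c i))).
    by apply: allpairs_f => //; rewrite mem_enum.
  move: x_cut; have := valP (circle_rot alpha (- n) (c i)).
  move: (circle_rot alpha (- n) (c i)) => p.
  have := valP y; rewrite !cdistE xy /=.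
  by case: (leP (sval x) (sval p)) => ?; lra.
move=> x y rxy n nS; have [xy|/ltW yx] := leP (sval x) (sval y).
  by rewrite (mono x y).
by rewrite (mono y x).
Qed.

Lemma orbit_closure_tame (z : circle R) :
  tame_system R (orbit_closure_act (phi := coding alpha f z)).
Proof.
have [_ ractD] := rot_action alpha.
set phi := coding alpha f z; pose X := set_type (orbit_closure phi).
have [cX _] := orbit_closure_isomorphic z.
apply: (@linear_complexity_tame R _ _ (orbit_closure_act (phi := phi)) _
  (fun w : X => (set_val w : full_shift) 0) d.+1) => [||S].
- exact: orbit_closure_system.
- exact: orbit_closure_separating.
have [r r_le rP] := coding_complexity S.
have /choice[n_ n_P] := fun w : X => orbit_closure_pattern w S.
exists (fun w => r (circle_rot alpha (n_ w) z)) => // w w' /rP agree g gS.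
rewrite !orbit_closure_act0 (n_P w g gS) (n_P w' g gS) /phi /coding !ractD.
exact: agree.
Qed.

End SplitColor.

Theorem theorem5p3 (R : realType) (k d : nat) (k_gt0 : (1 <= k)%N)
    (d_gt0 : (1 <= d)%N) (alpha : 'I_k -> circle R)
    (alpha_irr : exists i, irrational (sval (alpha i)))
    (f : circle R -> 'I_d.+1) (f_proper : proper_coloring f) (z : circle R) :
  let phi : {ffun 'I_k -> int} -> 'I_d.+1 := coding alpha f z in
  (exists (A : set (circle R)) (invA : rot_invariant alpha A),
     [/\ compact_system (split_act invA),
         circularly_ordered_by (split_order A) (split_act invA),
         minimal (split_act invA),
         metrizable R (split_circle A) &
         isomorphic (orbit_closure_act (phi := phi)) (split_act invA)]) /\
  tame_system R (orbit_closure_act (phi := phi)) /\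
  tame_function (fun n => (phi n)%:R : R).
Proof.
have [c [c_inj _ f_const f_diff]] := f_proper.
have tameX := orbit_closure_tame d_gt0 c_inj f_const f_diff alpha_irr z.
have sep := split_itinerary_separating d_gt0 c_inj f_const f_diff alpha_irr.
move=> phi; split; last split=> //.
  exists (cut_orbit (alpha := alpha) (c := c)),
    (@cut_orbit_invariant _ _ _ alpha c).
  split.
  - split; first exact: split_compact.
    + exact: separating_hausdorff sep.
    + exact: split_act_is_action.
    + exact: split_act_continuous.
  - exact: split_circularly_ordered.
  - exact: split_minimal.
  - exact: separating_compact_metrizable (@split_compact _ _) sep.
  - exact: (orbit_closure_isomorphic d_gt0 c_inj f_const f_diff alpha_irr z).2.
apply: (@orbit_closure_tame_function _ _ phi R
  (fun a => (a : nat)%:R) d.+1%:R) => //.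
by move=> a; rewrite ger0_norm// ler_nat ltnW.
Qed.
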